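(* Assume $\tau=\mathrm{id}$ and fix $\overline p_i\in\mathbb Z_2=\mathbb Z/2\mathbb Z$ for each $i\in I$. Then the split $\imath$quantum group $\mathbf U^\imath$ has a presentation (as a $\mathbb K(q)$-algebra) with generators $B_i$ $(i\in I)$ and relations $$\sum_{n=0}^{1-a_{ij}}(-1)^nB_{i,\overline{a_{ij}}+\overline p_i}^{(n)}B_jB_{i,\overline p_i}^{(1-a_{ij}-n)}=0\qquad(i\neq j\in I).$$ Moreover, $\mathbf U^\imath$ admits a $\mathbb K(q)$-algebra anti-involution $\sigma$ which sends $B_i\mapsto B_i$ for all $i\in I$.
   Context: Root datum. $(I,\cdot)$ is a Cartan datum: $I$ is a finite set and $\cdot$ is a symmetric bilinear form on $\mathbb Z[I]$ with $i\cdot i\in\{2,4,6,\dots\}$ and $2\frac{i\cdot j}{i\cdot i}\in\{0,-1,-2,\dots\}$ for $i\ne j$. A root datum of type $(I,\cdot)$ is given: finitely generated free abelian groups $Y,X$ with a perfect bilinear pairing $\langle\cdot,\cdot\rangle:Y\times X\to\mathbb Z$, and embeddings $I\to X$, $i\mapsto\alpha_i$, $I\to Y$, $i\mapsto h_i$, with $a_{ij}:=\langle h_i,\alpha_j\rangle=2\frac{i\cdot j}{i\cdot i}$. The families $\{\alpha_i\}$ and $\{h_i\}$ are assumed linearly independent. Put $\epsilon_i=\frac{i\cdot i}{2}$. $\mathbb K$ is a field of characteristic $0$, $q$ an indeterminate, $q_i=q^{\epsilon_i}$. Put $[n]_{q_i}=\frac{q_i^n-q_i^{-n}}{q_i-q_i^{-1}}$,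 $[m]_{q_i}^!=[1]_{q_i}\cdots[m]_{q_i}$, $\begin{bmatrix}n\\d\end{bmatrix}_{q_i}=\frac{[n]_{q_i}\cdots[n-d+1]_{q_i}}{[d]_{q_i}^!}$ for $d\ge0$. Quantum group. $\mathbf U$ is the associative $\mathbb K(q)$-algebra with generators $E_i,F_i$ ($i\in I$), $K_h$ ($h\in Y$) and relations $K_0=1$, $K_hK_{h'}=K_{h+h'}$, $K_hE_i=q^{\langle h,\alpha_i\rangle}E_iK_h$, $K_hF_i=q^{-\langle h,\alpha_i\rangle}F_iK_h$, $[E_i,F_j]=\delta_{ij}\frac{\widetilde K_i-\widetilde K_i^{-1}}{q_i-q_i^{-1}}$ with $\widetilde K_i=K_{h_i}^{\epsilon_i}$, and $S_{ij}(E_i,E_j)=0=S_{ij}(F_i,F_j)$ for $i\ne j$, where $S_{ij}(x,y)=\sum_{n=0}^{1-a_{ij}}(-1)^n\begin{bmatrix}1-a_{ij}\\ n\end{bmatrix}_{q_i}x^nyx^{1-a_{ij}-n}$. Split $\imath$quantum group. This is the case $\tau=\mathrm{id}$ (on $I$, $X$ and $Y$) of the quasi-split $\imath$quantum groups. The parameters are $\varsigma=(\varsigma_i)_{i\in I}\in(\mathbb K(q)^\times)^I$ and $\kappa=(\kappa_i)_{i\in I}\in\mathbb K(q)^I$ such that $\kappa_i=0$ unless $\langle h_k,\alpha_i\rangle\in2\mathbb Z$ for all $k\in I$. $\mathbf U^\imath=\mathbf U^\imath_{\varsigma,\kappa}$ is the $\mathbb K(q)$-subalgebra of $\mathbf U$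 generated by $B_i=F_i+\varsigma_iE_i\widetilde K_i^{-1}+\kappa_i\widetilde K_i^{-1}$ ($i\in I$). $\imath$Divided powers. For $\overline p\in\mathbb Z_2=\{\bar0,\bar1\}$: $B_{i,\bar1}^{(m)}=\frac1{[m]_{q_i}^!}B_i\prod_{j=1}^k(B_i^2-q_i\varsigma_i[2j-1]_{q_i}^2)$ if $m=2k+1$, and $\frac1{[m]_{q_i}^!}\prod_{j=1}^k(B_i^2-q_i\varsigma_i[2j-1]_{q_i}^2)$ if $m=2k$; $B_{i,\bar0}^{(m)}=\frac1{[m]_{q_i}^!}B_i\prod_{j=1}^k(B_i^2-q_i\varsigma_i[2j]_{q_i}^2)$ if $m=2k+1$, and $\frac1{[m]_{q_i}^!}\prod_{j=1}^k(B_i^2-q_i\varsigma_i[2j-2]_{q_i}^2)$ if $m=2k$. For $k\in\mathbb Z$, $\overline k$ denotes its class in $\mathbb Z_2$. *)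

(* Defs.v *)
From HB Require Import structures.
From mathcomp Require Import all_boot all_order all_algebra.
From mathcomp Require Import boolp.
From mathcomp Require Import monalg.

Set Implicit Arguments.
Unset Strict Implicit.
Unset Printing Implicit Defensive.

Import GRing.Theory.
Local Open Scope ring_scope.

Section Presentation.
Variables (R : fieldType) (G : choiceType).

Definition free_alg := {malg R[{fmonom G}]}.
HB.instance Definition _ := GRing.Lalgebra.on free_alg.

Definition fvar (x : G) : free_alg := << fmu x >>.

Inductive ideal_of (rel : free_alg -> Prop) : free_alg -> Prop :=
| ideal_of0 : ideal_of rel 0
| ideal_ofD u v : ideal_of rel u -> ideal_of rel v -> ideal_of rel (u + v)
| ideal_ofM u r v : rel r -> ideal_of rel (u * r * v).

Variable A : algType R.

Definition free_eval (g : G -> A) : free_alg -> A :=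
  mmap (fun c : R => c%:A) (fun m : {fmonom G} => \prod_(x <- m) g x).

(* [rel] is the set of relators (elements set equal to 0): the canonical
   morphism from the free algebra to [A] is onto, with kernel the two-sided
   ideal generated by [rel]. *)
Definition presents (g : G -> A) (rel : free_alg -> Prop) : Prop :=
  (forall a : A, exists u, free_eval g u = a) /\
  (forall u, free_eval g u = 0 <-> ideal_of rel u).

End Presentation.

Arguments fvar {R G} x.

Section Subalgebra.
Variables (R : fieldType) (G : Type) (A : algType R) (g : G -> A).

Inductive in_subalg : A -> Prop :=
| in_subalg_gen x : in_subalg (g x)
| in_subalg1 : in_subalg 1
| in_subalgZD c a b :
    in_subalg a -> in_subalg b -> in_subalg (c *: a + b)
| in_subalgM a b : in_subalg a -> in_subalg b -> in_subalg (a * b).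

Definition subalg_pred : {pred A} := fun a => `[< in_subalg a >].

Fact subalg_pred_closed : GRing.subalg_closed subalg_pred.
Proof.
split=> [|c a b /asboolP ha /asboolP hb|a b /asboolP ha /asboolP hb];
  apply/asboolP.
- exact: in_subalg1.
- exact: in_subalgZD.
- exact: in_subalgM.
Qed.

HB.instance Definition _ := GRing.isSubalgClosed.Build R A subalg_pred
  (GRing.subalg_closed_semi subalg_pred_closed).

Definition subalg := {a : A | subalg_pred a}.
HB.instance Definition _ := SubChoice.on subalg.
HB.instance Definition _ := [SubChoice_isSubAlgebra of subalg by <:].

Definition subalg_gen (x : G) : subalg :=
  exist _ (g x) (introT (asboolP _) (in_subalg_gen x)).

End Subalgebra.

Definition is_anti_involution (R : fieldType) (A : algType R)
    (s : {linear A -> A}) : Prop :=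
  [/\ s 1 = 1, forall a b : A, s (a * b) = s b * s a & involutive s].

(* The form on Z[I] is given by its values on the basis I; [dot_offdiag] says
   that 2 (i.j) / (i.i) = - n for some natural number n. *)
Record cartan_datum (I : finType) := CartanDatum {
  dot : I -> I -> int;
  dotC : forall i j, dot i j = dot j i;
  dot_diag : forall i, exists n : nat, dot i i = 2 * n.+1%:Z;
  dot_offdiag : forall i j, i != j ->
    exists n : nat, 2 * dot i j = - n%:Z * dot i i
}.

Definition eps (I : finType) (C : cartan_datum I) (i : I) : nat :=
  `|(dot C i i %/ 2)%Z|%N.

(* The division is exact, by [dot_offdiag]. *)
Definition cartan (I : finType) (C : cartan_datum I) (i j : I) : int :=
  ((2 * dot C i j) %/ dot C i i)%Z.

Definition fg_free (Z : zmodType) : Prop :=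
  exists (n : nat) (b : 'I_n -> Z),
    bijective (fun c : {ffun 'I_n -> int} => \sum_i b i *~ c i).

Definition Z_independent (I : finType) (Z : zmodType) (v : I -> Z) : Prop :=
  forall c : I -> int, \sum_i v i *~ c i = 0 -> forall i, c i = 0.

(* The independence conditions are not part of the usual notion of root datum;
   they imply that the maps [simple_coroot] and [simple_root] are embeddings. *)
Record root_datum (I : finType) (C : cartan_datum I) := RootDatum {
  Ylat : zmodType;
  Xlat : zmodType;
  Ylat_free : fg_free Ylat;
  Xlat_free : fg_free Xlat;
  pairing : Ylat -> Xlat -> int;
  pairingDl : forall x, {morph pairing^~ x : h h' / h + h'};
  pairingDr : forall h, {morph pairing h : x x' / x + x'};
  pairing_perfectl : forall f : {additive Xlat -> int},
    exists! h : Ylat, forall x, f x = pairing h x;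
  pairing_perfectr : forall f : {additive Ylat -> int},
    exists! x : Xlat, forall h, f h = pairing h x;
  simple_coroot : I -> Ylat;
  simple_root : I -> Xlat;
  pairing_cartan : forall i j, pairing (simple_coroot i) (simple_root j) = cartan C i j;
  simple_coroot_indep : Z_independent simple_coroot;
  simple_root_indep : Z_independent simple_root
}.

Definition Kq (K : fieldType) : fieldType := {fraction {poly K}}.
Definition qq (K : fieldType) : Kq K := @FracField.tofrac {poly K} 'X.

Section QuantumIntegers.
Variables (k : fieldType) (v : k).

Definition qint (n : int) : k := (v ^ n - v ^ (- n)) / (v - v^-1).
Definition qfact (m : nat) : k := \prod_(1 <= j < m.+1) qint j%:Z.
Definition qbinom (n : int) (d : nat) : k :=
  (\prod_(j < d) qint (n - j%:Z)) / qfact d.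

End QuantumIntegers.

Section QuantumGroup.
Variables (K : fieldType) (I : finType) (C : cartan_datum I).
Variable D : root_datum C.

Definition qi (i : I) : Kq K := qq K ^+ eps C i.

(* Meaningful when a_ij <= 1, which holds for i != j. *)
Definition serre_deg (i j : I) : nat := `|1 - cartan C i j|%N.

Definition serre (A : lalgType (Kq K)) (i j : I) (x y : A) : A :=
  \sum_(n < (serre_deg i j).+1)
    ((-1) ^+ n * qbinom (qi i) (1 - cartan C i j) n) *:
      (x ^+ n * y * x ^+ (serre_deg i j - n)).

(* The inverse of K_h is K_{-h}. *)
Definition Ktilde (A : lalgType (Kq K)) (Kh : Ylat D -> A) (i : I) : A :=
  Kh (simple_coroot D i) ^+ eps C i.
Definition Ktilde_inv (A : lalgType (Kq K)) (Kh : Ylat D -> A) (i : I) : A :=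
  Kh (- simple_coroot D i) ^+ eps C i.

Definition qgroup_index : choiceType := (I + I + Ylat D)%type.

Definition fE (i : I) : free_alg (Kq K) qgroup_index := fvar (inl (inl i)).
Definition fF (i : I) : free_alg (Kq K) qgroup_index := fvar (inl (inr i)).
Definition fK (h : Ylat D) : free_alg (Kq K) qgroup_index := fvar (inr h).

Inductive qgroup_rel : free_alg (Kq K) qgroup_index -> Prop :=
| qgroup_K0 : qgroup_rel (fK 0 - 1)
| qgroup_KK h h' : qgroup_rel (fK h * fK h' - fK (h + h'))
| qgroup_KE h i :
    qgroup_rel (fK h * fE i - qq K ^ pairing h (simple_root D i) *: (fE i * fK h))
| qgroup_KF h i :
    qgroup_rel (fK h * fF i - qq K ^ (- pairing h (simple_root D i)) *: (fF i * fK h))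
| qgroup_EF i j :
    qgroup_rel (fE i * fF j - fF j * fE i -
      (if i == j then (qi i - (qi i)^-1)^-1 *: (Ktilde fK i - Ktilde_inv fK i)
       else 0))
| qgroup_SE i j : i != j -> qgroup_rel (serre i j (fE i) (fE j))
| qgroup_SF i j : i != j -> qgroup_rel (serre i j (fF i) (fF j)).

Definition qgroup_gen (U : Type) (E F : I -> U) (Kh : Ylat D -> U)
    (x : qgroup_index) : U :=
  match x with inl (inl i) => E i | inl (inr i) => F i | inr h => Kh h end.

Definition is_qgroup (U : algType (Kq K)) (E F : I -> U) (Kh : Ylat D -> U)
  : Prop := presents (qgroup_gen E F Kh) qgroup_rel.

Section IQuantumGroup.
Variables (vs kap : I -> Kq K).

Definition iparams : Prop :=
  (forall i, vs i != 0) /\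
  (forall i, ~ (forall k, (2 %| pairing (simple_coroot D k) (simple_root D i))%Z) ->
    kap i = 0).

Definition Belt (U : algType (Kq K)) (E F : I -> U) (Kh : Ylat D -> U) (i : I)
  : U :=
  F i + vs i *: (E i * Ktilde_inv Kh i) + kap i *: Ktilde_inv Kh i.

Definition iqgroup (U : algType (Kq K)) (E F : I -> U) (Kh : Ylat D -> U) :=
  subalg (Belt E F Kh).

(* [idivpow p i m b] is the m-th idivided power of parity p attached to i,
   evaluated at b. *)
Definition idivpow (A : lalgType (Kq K)) (p : 'Z_2) (i : I) (m : nat) (b : A)
  : A :=
  let factor (n : int) := b ^+ 2 - (qi i * vs i * qint (qi i) n ^+ 2)%:A in
  let k := m./2 in
  (qfact (qi i) m)^-1 *:
  (if p == 1 then
     b ^+ odd m * \prod_(1 <= j < k.+1) factor (2 * j%:Z - 1)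
   else if odd m then
     b * \prod_(1 <= j < k.+1) factor (2 * j%:Z)
   else
     \prod_(1 <= j < k.+1) factor (2 * j%:Z - 2)).

Definition iserre (A : lalgType (Kq K)) (p : I -> 'Z_2) (i j : I) (B : I -> A)
  : A :=
  \sum_(n < (serre_deg i j).+1)
    (-1) ^+ n *: (idivpow ((cartan C i j)%:~R + p i) i n (B i) * B j *
                  idivpow (p i) i (serre_deg i j - n) (B i)).

Inductive iserre_rel (p : I -> 'Z_2) : free_alg (Kq K) I -> Prop :=
| iserre_relator i j : i != j -> iserre_rel p (iserre p i j fvar).

End IQuantumGroup.

End QuantumGroup.

(* Main.v *)
(* Relations. Put m = 1 - a_ij and let B = B_i act on the left and on the right.
   The i-Serre expression of x is, up to a scalar, obtained by applying to x the
   quadratic operators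
     x |-> B^2 x - (q^r + q^-r) B x B + x B^2 - q vs_i [r]^2 x,   r = m-1, m-3, .. > 0
   (and x |-> B x - x B if m is odd); in particular it does not depend on the
   parity p_i. Each summand of B_j is killed. The elements F_j and E_j K_j^-1
   generate, under q-commutators, a chain of length m on which B acts by a
   three-term recurrence; a quadratic operator maps the chain of length m to one
   of length m - 2. The element K_j^-1 behaves like a power K_i^r, and the
   quadratic operator lowers r.

   Presentation. U acts on the quotient of the free algebra on I by the Serre
   ideal, a Verma module of highest weight 0. If u(B) = 0 then u(B) 1 = 0 there,
   and the top degree part of u(B) 1 is that of u: it lies in the Serre ideal.
   The i-Serre relators having the Serre relators as leading terms, u can be
   lowered in degree modulo the i-Serre ideal.

   Anti-involution. Reversing words maps an i-Serre relator to one for another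
   parity, that is, up to sign, to itself. *)
Require Import Defs.
From HB Require Import structures.
From mathcomp Require Import all_boot all_order all_algebra.
From mathcomp Require Import finmap boolp monalg.
From mathcomp Require Import ring zify.

Set Implicit Arguments.
Unset Strict Implicit.
Unset Printing Implicit Defensive.

Import GRing.Theory.
Local Open Scope ring_scope.

(** * Noncommutative polynomial identities *)

(** The summand $E_jK_j^{-1}$ of $B_j$ reduces to the summand $F_j$: exchanging $F_i$ with
    $\varsigma_iE_iK_i^{-1}$ amounts to replacing $q_i$ by its inverse, and the idivided powers do
    not change as long as $q_i\varsigma_i$ is kept. For $K_j^{-1}$ a quadratic operator leaves
    several terms, one of them with a Casimir-like factor; since $\kappa_j\neq0$ forces $a_{ij}$ to
    be even, the descent ends in a plain commutator with an element that commutes with $B_i$. On the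
    free algebra the Serre relations between the $F_i$ hold only modulo the Serre ideal. The
    quotient is not formed: $E_i,F_i,K_h$ are operators on the free algebra itself, all the other
    relations hold exactly, and the operators preserve the Serre ideal because $E_l$ commutes with
    the Serre elements in the $F_i$. The i-Serre relators are inhomogeneous while the Serre ideal is
    graded. So the comparison goes through single components: each homogeneous component of an
    element of the Serre ideal is the top part of an element of the i-Serre ideal. *)

Inductive ncexpr (R : Type) :=
| NCvar of nat | NC0 | NC1 | NCadd of ncexpr R & ncexpr R | NCopp of ncexpr R
| NCmul of ncexpr R & ncexpr R | NCscale of R & ncexpr R.
Arguments NCvar {R}. Arguments NC0 {R}. Arguments NC1 {R}.

Section NCReflection.
Variables (R : comPzRingType) (A : algType R).
Implicit Types (e : ncexpr R) (l : list (R * list nat)) (w : list nat).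

Fixpoint nc_interp (env : list A) e : A :=
  match e with
  | NCvar n => nth 0 env n
  | NC0 => 0
  | NC1 => 1
  | NCadd e1 e2 => nc_interp env e1 + nc_interp env e2
  | NCopp e1 => - nc_interp env e1
  | NCmul e1 e2 => nc_interp env e1 * nc_interp env e2
  | NCscale c e1 => c *: nc_interp env e1
  end.

(** Private copies of standard functions: [nc_algebra] can then unfold exactly these and leave the
    scalar coefficients untouched. *)
Fixpoint nc_app (T : Type) (s t : list T) :=
  match s with [::] => t | x :: s' => x :: nc_app s' t end.

Fixpoint nc_scale (c : R) w l :=
  match l with
  | [::] => [::]
  | (d, w') :: l' => (c * d, nc_app w w') :: nc_scale c w l'
  end.

Fixpoint nc_mul l1 l2 :=
  match l1 with
  | [::] => [::]
  | (c, w) :: l => nc_app (nc_scale c w l2) (nc_mul l l2)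
  end.

Fixpoint nc_norm e : list (R * list nat) :=
  match e with
  | NCvar n => [:: (1, [:: n])]
  | NC0 => [::]
  | NC1 => [:: (1, [::])]
  | NCadd e1 e2 => nc_app (nc_norm e1) (nc_norm e2)
  | NCopp e1 => nc_scale (-1) [::] (nc_norm e1)
  | NCmul e1 e2 => nc_mul (nc_norm e1) (nc_norm e2)
  | NCscale c e1 => nc_scale c [::] (nc_norm e1)
  end.

Fixpoint nc_eqn (m n : nat) : bool :=
  match m, n with
  | O, O => true | S m', S n' => nc_eqn m' n' | _, _ => false
  end.

Fixpoint nc_eqw w1 w2 : bool :=
  match w1, w2 with
  | [::], [::] => true
  | a :: s, b :: t => if nc_eqn a b then nc_eqw s t else false
  | _, _ => false
  end.

Fixpoint nc_coef w l : R :=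
  match l with
  | [::] => 0
  | (c, w') :: l' => if nc_eqw w w' then c + nc_coef w l' else nc_coef w l'
  end.

Fixpoint nc_rem w l : list (R * list nat) :=
  match l with
  | [::] => [::]
  | (c, w') :: l' => if nc_eqw w w' then nc_rem w l' else (c, w') :: nc_rem w l'
  end.

(** [n] is fuel, as [nc_rem] does not return a subterm. Each step collects all occurrences of the
    first word, so the length of [l] suffices. The outcome is a conjunction of scalar equations, to
    be closed by [ring] or [field]. *)
Fixpoint nc_null (n : nat) l : Prop :=
  match n, l with
  | _, [::] => True
  | O, _ => False
  | S n', (c, w) :: l' => c + nc_coef w l' = 0 /\ nc_null n' (nc_rem w l')
  end.

Fixpoint nc_word (env : list A) w : A :=
  match w with [::] => 1 | n :: w' => nth 0 env n * nc_word env w' end.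

Fixpoint nc_eval (env : list A) l : A :=
  match l with
  | [::] => 0 | (c, w) :: l' => c *: nc_word env w + nc_eval env l'
  end.

Lemma nc_word_app env w1 w2 :
  nc_word env (nc_app w1 w2) = nc_word env w1 * nc_word env w2.
Proof. by elim: w1 => [|n w1 IH] /=; rewrite ?mul1r // IH mulrA. Qed.

Lemma nc_eval_app env l1 l2 :
  nc_eval env (nc_app l1 l2) = nc_eval env l1 + nc_eval env l2.
Proof. by elim: l1 => [|[c w] l1 IH] /=; rewrite ?add0r // IH addrA. Qed.

Lemma nc_eval_scale env c w l :
  nc_eval env (nc_scale c w l) = c *: (nc_word env w * nc_eval env l).
Proof.
elim: l => [|[d w'] l IH] /=; first by rewrite mulr0 scaler0.
by rewrite IH nc_word_app mulrDr scalerDr -scalerAr scalerA.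
Qed.

Lemma nc_eval_mul env l1 l2 :
  nc_eval env (nc_mul l1 l2) = nc_eval env l1 * nc_eval env l2.
Proof.
elim: l1 => [|[c w] l1 IH] /=; first by rewrite mul0r.
by rewrite nc_eval_app nc_eval_scale IH mulrDl -scalerAl.
Qed.

Lemma nc_normP env e : nc_interp env e = nc_eval env (nc_norm e).
Proof.
elim: e => [n|||e1 IH1 e2 IH2|e IH|e1 IH1 e2 IH2|c e IH] //=;
  rewrite ?scale1r ?mulr1 ?addr0 //.
- by rewrite nc_eval_app IH1 IH2.
- by rewrite nc_eval_scale /= mul1r scaleN1r IH.
- by rewrite nc_eval_mul IH1 IH2.
- by rewrite nc_eval_scale mul1r IH.
Qed.

Lemma nc_eqnP m n : nc_eqn m n -> m = n.
Proof. by elim: m n => [|m IH] [|n] //= /IH->. Qed.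

Lemma nc_eqwP w1 w2 : nc_eqw w1 w2 -> w1 = w2.
Proof.
elim: w1 w2 => [|a w1 IH] [|b w2] //=.
by case: ifP => // /nc_eqnP-> /IH->.
Qed.

Lemma nc_eval_rem env w l :
  nc_eval env l = nc_coef w l *: nc_word env w + nc_eval env (nc_rem w l).
Proof.
elim: l => [|[c w'] l IH] /=; first by rewrite scale0r addr0.
case: ifP => [/nc_eqwP<-|_]; first by rewrite scalerDl -addrA -IH.
by rewrite /= IH addrCA.
Qed.

Lemma nc_nullP env n l : nc_null n l -> nc_eval env l = 0.
Proof.
elim: n l => [|n IH] [|[c w] l] //= [cw0 /IH rem0].
by rewrite (nc_eval_rem env w) rem0 addr0 -scalerDl cw0 scale0r.
Qed.

Lemma nc_reflect env e1 e2 :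
  (let l := nc_norm (NCadd e1 (NCopp e2)) in nc_null (size l) l) ->
  nc_interp env e1 = nc_interp env e2.
Proof.
move=> /(nc_nullP env); rewrite -nc_normP /= => /eqP.
by rewrite subr_eq0 => /eqP.
Qed.

End NCReflection.

Ltac nc_mem x env :=
  lazymatch env with
  | @nil _ => constr:(false)
  | x :: _ => constr:(true)
  | _ :: ?env' => nc_mem x env'
  end.

Ltac nc_env env t :=
  lazymatch t with
  | @GRing.zero _ => env
  | @GRing.one _ => env
  | @GRing.add _ ?x ?y => let env := nc_env env x in nc_env env y
  | @GRing.mul _ ?x ?y => let env := nc_env env x in nc_env env y
  | @GRing.opp _ ?x => nc_env env x
  | @GRing.scale _ _ ?c ?x => nc_env env x
  | _ => match nc_mem t env with true => env | false => constr:(t :: env) end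
  end.

Ltac nc_index x env :=
  lazymatch env with
  | x :: _ => constr:(O)
  | _ :: ?env' => let n := nc_index x env' in constr:(S n)
  end.

Ltac nc_quote R env t :=
  lazymatch t with
  | @GRing.zero _ => constr:(@NC0 R)
  | @GRing.one _ => constr:(@NC1 R)
  | @GRing.add _ ?x ?y =>
      let a := nc_quote R env x in let b := nc_quote R env y in
      constr:(NCadd a b)
  | @GRing.mul _ ?x ?y =>
      let a := nc_quote R env x in let b := nc_quote R env y in
      constr:(NCmul a b)
  | @GRing.opp _ ?x => let a := nc_quote R env x in constr:(NCopp a)
  | @GRing.scale _ _ ?c ?x =>
      let a := nc_quote R env x in constr:(@NCscale R c a)
  | _ => let n := nc_index t env in constr:(@NCvar R n)
  end.

(* Reduces an equation in an algebra to the equality of the coefficients of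
   each noncommutative monomial in the atoms. *)
Ltac nc_algebra :=
  lazymatch goal with
  | |- @eq ?T ?x ?y =>
    let AR := constr:((fun (R : comPzRingType) (A : algType R) (_ : T = A) => A)
       _ _ (erefl T)) in
    let AR := eval cbv beta in AR in
    lazymatch type of AR with
    | GRing.Algebra.type ?R0 =>
      let R := constr:(GRing.PzRing.sort R0) in
      let env := nc_env (@nil T) x in
      let env := nc_env env y in
      let e1 := nc_quote R env x in
      let e2 := nc_quote R env y in
      refine (@nc_reflect _ AR env e1 e2 _);
      cbv [nc_norm nc_mul nc_scale nc_app nc_coef nc_rem nc_null nc_eqw nc_eqn
           size];
      repeat split
    end
  end.

(** * Quantum integers and idivided powers *)

(** Nonzero and not a root of unity. The rank one and rank two arguments are carried out for such a
    [q], because they are applied both to $q_i$ and to its inverse. *)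
Definition generic (k : fieldType) (q : k) : Prop :=
  q != 0 /\ forall n : nat, q ^+ n.+1 != 1.

Section QuantumIntegerTheory.
Variables (k : fieldType) (q : k).
Hypothesis q_gen : generic q.

Lemma generic_neq0 : q != 0. Proof. by case: q_gen. Qed.
Lemma generic_expz_neq1 (n : int) : n != 0 -> q ^ n != 1.
Proof.
case: q_gen => q0 q1; case: n => [[|n]|n] // _; first exact: q1.
by rewrite NegzE -exprnN invr_eq1 q1.
Qed.

Lemma generic_expz_inj (m n : int) : m != n -> q ^ m - q ^ n != 0.
Proof.
move=> mn; rewrite subr_eq0; apply: contra_neq (@generic_expz_neq1 (m - n) _).
  by move=> e; rewrite expfzDr ?generic_neq0 // e -expfzDr ?generic_neq0 // subrr.
by rewrite subr_eq0.
Qed.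

Lemma generic_subV_neq0 : q - q^-1 != 0.
Proof. exact: (@generic_expz_inj 1 (-1)). Qed.

Lemma generic_sqr : q * q - 1 != 0.
Proof. by case: q_gen => _ /(_ 1); rewrite subr_eq0. Qed.

Lemma genericV : generic q^-1.
Proof.
case: q_gen => q0 q1; split=> [|n]; first by rewrite invr_eq0.
by rewrite exprVn invr_eq1.
Qed.

Lemma qint0 : qint q 0 = 0.
Proof. by rewrite /qint oppr0 subrr mul0r. Qed.

Lemma qint1 : qint q 1 = 1.
Proof. by rewrite /qint expr1z -exprN1 divff ?generic_subV_neq0. Qed.

Lemma qintE (n : int) : qint q n = (q ^ n - (q ^ n)^-1) / (q - q^-1).
Proof. by rewrite /qint -invr_expz. Qed.

Lemma qint_neq0 (n : int) : n != 0 -> qint q n != 0.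
Proof.
move=> n0; rewrite /qint mulf_neq0 ?invr_eq0 ?generic_subV_neq0 //.
by apply: generic_expz_inj; lia.
Qed.

Lemma qintV n : qint q^-1 n = qint q n.
Proof.
rewrite /qint invrK !exprz_inv opprK.
rewrite -[X in _ / X = _]opprB -[X in X / _ = _]opprB.
by rewrite invrN mulrN mulNr opprK.
Qed.

Lemma qfactS m : qfact q m.+1 = qfact q m * qint q m.+1.
Proof. by rewrite /qfact big_nat_recr. Qed.

Lemma qfact_neq0 m : qfact q m != 0.
Proof.
elim: m => [|m IH]; first by rewrite /qfact big_geq ?oner_neq0.
by rewrite qfactS mulf_neq0 ?qint_neq0.
Qed.

End QuantumIntegerTheory.

(* Locked because unification would otherwise unfold it to match products and
   scalings; [r] tells whether the parity is odd. *)
HB.lock Definition idp (k : fieldType) (q c : k) (A : lalgType k) (r : bool)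
    (m : nat) (b : A) : A :=
  let factor (n : int) := b ^+ 2 - (c * qint q n ^+ 2)%:A in
  (qfact q m)^-1 *:
  (if r then
     b ^+ odd m * \prod_(1 <= j < m./2.+1) factor (2 * j%:Z - 1)
   else if odd m then
     b * \prod_(1 <= j < m./2.+1) factor (2 * j%:Z)
   else
     \prod_(1 <= j < m./2.+1) factor (2 * j%:Z - 2)).

Section IDividedPowers.
Variables (k : fieldType) (q : k).
Hypothesis q_gen : generic q.
Variables (c : k) (A : algType k).
Implicit Types (r : bool) (b : A).

Local Notation idp := (@idp k q c A).

Lemma idp_comm r m (x b : A) : GRing.comm x b -> GRing.comm x (idp r m b).
Proof.
move=> xb; rewrite idp.unlock /GRing.comm -scalerAr -scalerAl; congr (_ *: _).
have comm_factor (n : int) : GRing.comm x (b ^+ 2 - (c * qint q n ^+ 2)%:A).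
  by apply: commrB; [apply: commrX | rewrite /GRing.comm mulr_algl mulr_algr].
by case: r; [|case: (odd m)]; repeat (apply: commrM || apply: commr_prod => *
  || apply: commrX).
Qed.

Lemma idp0 r b : idp r 0 b = 1.
Proof.
rewrite idp.unlock /= /qfact !big_geq // invr1 scale1r.
by case: r; rewrite ?mulr1.
Qed.

Lemma idp1 r b : idp r 1 b = b.
Proof.
rewrite idp.unlock /= /qfact big_nat1 !big_geq // qint1 // invr1 scale1r.
by case: r; rewrite ?mulr1.
Qed.

(** Two steps add one factor to the product; its index is whichever of [n], [n.+1] is odd when [r]
    holds and even otherwise. *)
Lemma idpSS r n b :
  (qint q n.+1 * qint q n.+2) *: idp r n.+2 b =
  (b ^+ 2 - (c * qint q (if odd n == r then n else n.+1) ^+ 2)%:A) * idp r n b.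
Proof.
have nz m : qint q m.+1 != 0 by apply: qint_neq0.
set y := (X in X * idp r n b).
have -> : y * idp r n b = idp r n b * y.
  apply: idp_comm; apply: commr_sym; apply: commrB; first exact: commrX.
  by rewrite /GRing.comm mulr_algl mulr_algr.
rewrite idp.unlock !qfactS /= -scalerAl scalerA !negbK.
have -> : qint q n.+1 * qint q n.+2 / (qfact q n * qint q n.+1 * qint q n.+2) =
   (qfact q n)^-1.
  by field; rewrite !nz (qfact_neq0 q_gen).
rewrite {}/y; congr (_ *: _).
have := odd_double_half n.
case: r; case: (odd n) => /= n2; rewrite big_nat_recr //=
  ?(mulrA (b ^+ _)) ?(mulrA b);
  congr (_ * (_ - (_ * qint q _ ^+ 2)%:A)); lia.
Qed.

Lemma idpS_neq r n b :
  odd n != r -> b * idp r n b = qint q n.+1 *: idp r n.+1 b.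
Proof.
have nz m : qint q m.+1 != 0 by apply: qint_neq0.
move=> nr; rewrite idp.unlock qfactS -scalerAr scalerA /=.
have -> : qint q n.+1 / (qfact q n * qint q n.+1) = (qfact q n)^-1.
  by field; rewrite nz (qfact_neq0 q_gen).
congr (_ *: _); case: r nr; have := uphalf_half n; case: (odd n) => //= nE _.
  by rewrite nE mul1r.
(* For the even parity the first factor on the right has index 0 and equals [b ^+ 2]. *)
rewrite nE add1n [RHS]big_nat_recl // mulrA -expr2.
congr (_ * _); first by rewrite qint0 expr0n mulr0 scale0r subr0.
apply: eq_bigr => j _; congr (_ - (_ * qint q _ ^+ 2)%:A); lia.
Qed.

(** When [n] has the parity [r], [b] times the [n]-th power is [b ^+ 2] times the previous one by
    [idpS_neq], and [idpSS] accounts for [b ^+ 2]. At [n = 0] the default value of [n.-1] is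
    harmless: its coefficient contains $[0]=0$. *)
Lemma idpS r n b :
  b * idp r n b = qint q n.+1 *: idp r n.+1 b +
    (if odd n == r then c * qint q n else 0) *: idp r n.-1 b.
Proof.
have nz m : qint q m.+1 != 0 by apply: qint_neq0.
case: eqP => [nr|/eqP nr]; last by rewrite scale0r addr0 idpS_neq.
case: n nr => [|n] nr /=.
  by rewrite [qint q 0%N]qint0 mulr0 scale0r addr0 idp0 mulr1 idp1 qint1 // scale1r.
have nr' : odd n != r by rewrite -nr /=; case: (odd n).
apply: (scalerI (nz n)).
rewrite scalerAr -(idpS_neq _ nr') scalerDr !scalerA idpSS (negPf nr').
rewrite [b * (b * _)]mulrA -expr2.
rewrite mulrBl mulr_algl addrAC -addrA -scalerBl.
by rewrite (_ : _ - _ = 0) ?scale0r ?addr0 //; ring.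
Qed.

End IDividedPowers.

(** * Factorisation of the i-Serre expression into quadratic operators *)

Section IDividedSerre.
Variables (k : fieldType) (q : k).
Hypothesis q_gen : generic q.
Variables (c : k) (A : algType k).
Implicit Types (r : bool) (b x : A).

(** The left parity is shifted by [odd m.+1] because $a_{ij}=1-m$. The middle factor is an arbitrary
    [x], so that the expression becomes a linear operator, to be applied to each summand of
    $B_j$. *)
Definition iser r (m : nat) b x : A :=
  \sum_(n < m.+1) (-1) ^+ n *:
    (idp q c (odd m.+1 (+) r) n b * x * idp q c r (m - n) b).

(** With $L,R$ the left and right multiplications by [b], this is $(L-q^nR)(L-q^{-n}R)-c[n]^2$: two
    linear factors of the ordinary q-Serre operator, deformed by a constant. *)
Definition quad (n : nat) b x : A :=
  b * b * x - (q ^+ n + q ^- n) *: (b * x * b) + x * (b * b)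
  - (c * qint q n ^+ 2) *: x.

(** Lets the constant of [quad] cancel against the constants that [idpSS] produces on the two
    sides. *)
Lemma qint_sqrD (n l : nat) :
  qint q n ^+ 2 + qint q l ^+ 2 +
    (q ^+ (n + l) + q ^- (n + l)) * (qint q n * qint q l) = qint q (n + l)%N ^+ 2.
Proof.
rewrite !qintE // exprD -!exprnP exprD.
have q0 := generic_neq0 q_gen.
have := expf_neq0 n q0; have := expf_neq0 l q0.
move: (q ^+ n) (q ^+ l) => a b b0 a0.
by field; rewrite q0 a0 b0 generic_sqr.
Qed.

(** Adds up the three contributions to the summand of index [n] once the sums in [iserSS] have been
    realigned. *)
Lemma qint_triple (n l m : nat) : (n + l = m.+2)%N ->
  qint q (n%:Z - 1) * qint q n + qint q (l%:Z - 1) * qint q l +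
    (q ^+ m.+1 + q ^- m.+1) * (qint q n * qint q l) = qint q m.+1 * qint q m.+2.
Proof.
move=> nlm; have q0 := generic_neq0 q_gen.
have -> : q ^+ m.+1 = q ^ n * q ^ l / q.
  rewrite -!exprnP -exprD nlm [in RHS]exprS mulrC mulKf //.
have -> : qint q m.+1 = qint q ((n%:Z + l%:Z) - 1) by congr qint; lia.
have -> : qint q m.+2 = qint q (n%:Z + l%:Z) by congr qint; lia.
rewrite !qintE !expfzDr // -!exprnP exprN1.
have := expf_neq0 n q0; have := expf_neq0 l q0.
move: (q ^+ n) (q ^+ l) => a b b0 a0.
by field; rewrite q0 a0 b0 generic_sqr.
Qed.


Lemma iser_comm_r r m b x y :
  GRing.comm y b -> iser r m b (x * y) = iser r m b x * y.
Proof.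
move=> yb; rewrite /iser mulr_suml; apply: eq_bigr => n _.
by rewrite -scalerAl -!mulrA (idp_comm _ _ _ _ yb).
Qed.

Lemma iser_comm_l r m b x y :
  GRing.comm y b -> iser r m b (y * x) = y * iser r m b x.
Proof.
move=> yb; rewrite /iser mulr_sumr; apply: eq_bigr => n _.
by rewrite -scalerAr !mulrA (idp_comm _ _ _ _ yb).
Qed.

Lemma iserD r m b : {morph iser r m b : x y / x + y}.
Proof.
move=> x y; rewrite /iser -big_split; apply: eq_bigr => n _.
by rewrite /= mulrDr mulrDl scalerDr.
Qed.

Lemma iserZ r m b a x : iser r m b (a *: x) = a *: iser r m b x.
Proof.
rewrite /iser scaler_sumr; apply: eq_bigr => n _.
by rewrite -scalerAr -scalerAl !scalerA mulrC.
Qed.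

Lemma iser0 r b x : iser r 0 b x = x.
Proof. by rewrite /iser big_ord1 !idp0 mulr1 mul1r scale1r. Qed.

Lemma iser1 r b x : iser r 1 b x = x * b - b * x.
Proof.
rewrite /iser big_ord_recl big_ord1 /= !idp0 !idp1 // mulr1 mul1r scale1r.
by rewrite expr1 scaleN1r.
Qed.

(** Letting the [b]'s of [quad] act on the idivided powers gives terms of total degree [m.+2], which
    add up by [qint_triple], and terms of total degree [m]. Thanks to the parity shift the latter
    come from only one of the two powers at a time, and they telescope. *)
Lemma iserSS r m b x :
  (qint q m.+1 * qint q m.+2) *: iser r m.+2 b x = iser r m b (quad m.+1 b x).
Proof.
pose r' := odd m.+1 (+) r; pose e (n : nat) := odd n == r'.
pose u (n : nat) := idp q c r' n b; pose v (l : nat) := idp q c r l b.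
pose T (n l : nat) := u n * x * v l; pose t := q ^+ m.+1 + q ^- m.+1.
(* The lower terms. [V] vanishes at both ends, [0] and [m.+1], which is why the telescoping sum is
   zero. *)
pose V (n : nat) : A := (qint q n * qint q (m.+1 - n)%N) *:
  (T n (m - n)%N + T n.-1 (m - n.-1)%N).
have bu n : b * u n = qint q n.+1 *: u n.+1 +
    (if e n then c * qint q n else 0) *: u n.-1 by exact: idpS.
have bbu n : b * b * u n = (qint q n.+1 * qint q n.+2) *: u n.+2 +
    (c * qint q (if e n then n else n.+1) ^+ 2) *: u n.
  by rewrite idpSS // mulrBl mulr_algl expr2 subrK.
have vC l : b * v l = v l * b by exact: idp_comm.
have term n : (n <= m)%N -> u n * quad m.+1 b x * v (m - n)%N =
  ((qint q n.+1 * qint q n.+2) *: T n.+2 (m - n)%N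
   - (t * (qint q n.+1 * qint q (m - n).+1)) *: T n.+1 (m - n).+1
   + (qint q (m - n).+1 * qint q (m - n).+2) *: T n (m - n).+2)
  - (c * t) *: (if e n then V n else V n.+1).
  move=> nm; set l := (m - n)%N.
  (* Here the shift of the left parity is used: of the two powers in a summand, exactly one produces
     a lower term under [b]. *)
  have el : (odd l == r) = ~~ e n.
    by rewrite /e /l oddB // /r' /=; case: (odd m) (odd n) (r) => [] [] [].
  have bv : b * v l = qint q l.+1 *: v l.+1 +
    (if e n then 0 else c * qint q l) *: v l.-1.
    by rewrite [LHS]idpS // el; case: (e n).
  have bbv : b * b * v l = (qint q l.+1 * qint q l.+2) *: v l.+2 +
    (c * qint q (if e n then l.+1 else l) ^+ 2) *: v l.
    by rewrite idpSS // el mulrBl mulr_algl expr2; case: (e n); rewrite subrK.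
  have expand : u n * quad m.+1 b x * v l = (b * b * u n) * x * v l
     - t *: ((b * u n) * x * (b * v l)) + u n * x * (b * b * v l)
     - (c * qint q m.+1 ^+ 2) *: T n l.
    have ub : u n * b = b * u n by apply/esym/idp_comm.
    have -> : b * b * u n = u n * b * b by rewrite -mulrA -ub mulrA -ub.
    by rewrite /quad -/t /T -ub; nc_algebra; ring.
  have mE : (n + l = m)%N by rewrite /l subnKC.
  rewrite expand bbu bbv bu bv /V /T; case: (e n).
    have -> : qint q m.+1 ^+ 2 = qint q n ^+ 2 + qint q l.+1 ^+ 2 +
      t * (qint q n * qint q l.+1) by rewrite /t -mE -addnS qint_sqrD.
    case: (n) mE => [|n'] mE.
      by rewrite qint0; nc_algebra; ring.
    rewrite /= (_ : m - n' = l.+1)%N; last by lia.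
    rewrite (_ : m.+1 - n'.+1 = l.+1)%N; last by lia.
    rewrite (_ : m - n'.+1 = l)%N; last by lia.
    by nc_algebra; ring.
  have -> : qint q m.+1 ^+ 2 = qint q n.+1 ^+ 2 + qint q l ^+ 2 +
      t * (qint q n.+1 * qint q l) by rewrite /t -mE -addSn qint_sqrD.
  rewrite /= -/l subSS -/l (_ : m - n.+1 = l.-1)%N; last by lia.
  by nc_algebra; ring.
pose L (n : nat) : A :=
  ((-1) ^+ n * (qint q (n%:Z - 1) * qint q n)) *: T n (m.+2 - n)%N.
pose M (n : nat) : A :=
  ((-1) ^+ n * t * (qint q n * qint q (m.+2 - n)%N)) *: T n (m.+2 - n)%N.
pose N (n : nat) : A :=
  ((-1) ^+ n * (qint q ((m.+2 - n)%N%:Z - 1) * qint q (m.+2 - n)%N)) *: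
    T n (m.+2 - n)%N.
(* As [e] alternates, the lower term of the summand [n], with its sign, is the difference
   [G n.+1 - G n] up to the factor [c * t]. *)
pose G (n : nat) : A := (-1) ^+ n *: (if e n then V n else 0).
have L0 : L 0%N = 0 by rewrite /L [qint q 0%N]qint0 !mulr0 scale0r.
have L1 : L 1%N = 0 by rewrite /L [qint q _]qint0 mul0r mulr0 scale0r.
have M0 : M 0%N = 0 by rewrite /M [qint q 0%N]qint0 mul0r mulr0 scale0r.
have M2 : M m.+2 = 0 by rewrite /M subnn [qint q 0%N]qint0 !mulr0 scale0r.
have N1 : N m.+1 = 0.
  by rewrite /N subSnn [qint q (1%N%:Z - 1)]qint0 mul0r mulr0 scale0r.
have N2 : N m.+2 = 0 by rewrite /N subnn [qint q 0%N]qint0 !mulr0 scale0r.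
transitivity (\sum_(0 <= n < m.+3) (L n + M n + N n)).
  rewrite /iser scaler_sumr big_mkord; apply: eq_bigr => -[n /= nm] _.
  rewrite !negbK -/r' /L /M /N -!scalerDl scalerA; congr (_ *: _).
  by rewrite -(@qint_triple n (m.+2 - n) m) ?subnKC // -/t; ring.
(* [L] is shifted by two and [M] by one; the summands lost at the ends contain a factor $[0]$. *)
transitivity (\sum_(0 <= n < m.+1) ((L n.+2 + M n.+1 + N n) + (c * t) *: (G n.+1 - G n))).
  rewrite [RHS]big_split /= -scaler_sumr telescope_sumr // {1 2}/G.
  have -> : V 0%N = 0 by rewrite /V qint0 mul0r scale0r.
  have -> : V m.+1 = 0 by rewrite /V subnn qint0 mulr0 scale0r.
  rewrite !if_same !scaler0 subrr scaler0 addr0 !big_split /=.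
  congr (_ + _ + _).
  - by rewrite !big_nat_recl // L0 L1 !add0r.
  - by rewrite big_nat_recl // big_nat_recr //= M0 M2 add0r addr0.
  - by rewrite !big_nat_recr //= N1 N2 !addr0.
rewrite /iser -(big_mkord xpredT (fun n : nat =>
  (-1) ^+ n *: (u n * quad m.+1 b x * v (m - n)%N))).
apply: eq_big_nat => n /andP[_ nm]; rewrite term // /L /M /N /G.
rewrite !subSS (_ : m.+1 - n = (m - n).+1)%N; last by lia.
rewrite (_ : m.+2 - n = (m - n).+2)%N; last by lia.
rewrite (_ : n.+2%:Z - 1 = n.+1%:Z); last by lia.
rewrite (_ : (m - n).+2%:Z - 1 = (m - n).+1%:Z); last by lia.
have -> : e n.+1 = ~~ e n by rewrite /e /=; case: (odd n) (r') => [] [].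
by rewrite !exprS; case: (e n) => /=; nc_algebra; ring.
Qed.
End IDividedSerre.

Lemma ind2 (P : nat -> Prop) :
  P 0%N -> P 1%N -> (forall n, P n -> P n.+2) -> forall n, P n.
Proof.
move=> P0 P1 PS n; suff: P n /\ P n.+1 by case.
by elim: n => [|n [Pn PnS]]; split=> //; apply: PS.
Qed.

Section IDividedSerreVanishing.
Variables (k : fieldType) (q : k).
Hypothesis q_gen : generic q.
Variables (c : k) (A : algType k).
Implicit Types (r : bool) (b x : A).

(** The parity occurs neither in [quad] nor in the cases [m = 0] and [m = 1], to which [iserSS]
    reduces everything. *)
Lemma iser_parity r1 r2 m b x : iser q c r1 m b x = iser q c r2 m b x.
Proof.
elim/ind2: m x => [|| m IH] x; rewrite ?iser0 ?iser1 //.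
apply: (@scalerI _ _ (qint q m.+1 * qint q m.+2)).
  by rewrite mulf_neq0 ?qint_neq0.
by rewrite !iserSS // IH.
Qed.

Lemma iser_quad_eq0 r m b x :
  iser q c r m b (quad q c m.+1 b x) = 0 -> iser q c r m.+2 b x = 0.
Proof.
rewrite -iserSS // => /eqP; rewrite scaler_eq0 mulf_eq0.
by rewrite !(negPf (qint_neq0 q_gen _)) // => /eqP.
Qed.

Lemma idpV r m b : idp q^-1 c r m b = idp q c r m b.
Proof.
have qfV : qfact q^-1 m = qfact q m by apply: eq_bigr => j _; apply: qintV.
rewrite idp.unlock qfV; congr (_ *: _).
case: r; first by congr (_ * _); apply: eq_bigr => j _; rewrite qintV.
case: (odd m); first by congr (_ * _); apply: eq_bigr => j _; rewrite qintV.
by apply: eq_bigr => j _; rewrite qintV.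
Qed.

(** Quantum integers are invariant under inversion of [q], and [c] is held fixed. This is what
    carries the case of $F_j$ over to $E_jK_j^{-1}$. *)
Lemma iserV r m b x : iser q^-1 c r m b x = iser q c r m b x.
Proof. by apply: eq_bigr => n _; rewrite !idpV. Qed.

End IDividedSerreVanishing.

(** * Chains with a three-term recurrence *)

Section Chain.
Variables (k : fieldType) (q : k).
Hypothesis q_gen : generic q.
Variables (d : k) (A : algType k) (b : A).

(* The induction step replaces [f] by
   g_n = f_(n+2) + (q^(2n+2-N) - q^N) f_(n+1) b - d q^(2n+2) [N-n] [N-n-1] f_n,
   which satisfies the recurrence for N - 2 and has quad N (f_0) = g_0. *)
Lemma iser_chain r N (f : nat -> A) :
  (forall n : nat, (n <= N)%N ->
     b * f n = q ^ (n%:Z + n%:Z - N%:Z) *: (f n * b) + f n.+1 +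
      (d * q ^ (n%:Z + n%:Z - N%:Z) *
        (qint q n * qint q (N%:Z + 1 - n%:Z))) *: f n.-1) ->
  f N.+1 = 0 -> iser q (q * d) r N.+1 b (f 0%N) = 0.
Proof.
have q0 := generic_neq0 q_gen; have q2 := generic_sqr q_gen.
elim/ind2: N f => [f rec f1| f rec f2| N IH f rec fN].
- rewrite iser1 // (rec 0%N isT) f1.
  by rewrite [qint q 0%N]qint0; nc_algebra; rewrite ?expr0z; ring.
- apply: iser_quad_eq0 => //; rewrite iser0 /quad [qint q 1%N]qint1 //.
  have bf0 : b * f 0%N = q^-1 *: (f 0%N * b) + f 1%N.
    by rewrite (rec 0%N isT) [qint q 0%N]qint0 mul0r mulr0 scale0r addr0.
  have bf1 : b * f 1%N = q *: (f 1%N * b) + (d * q) *: f 0%N.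
    by rewrite (rec 1%N isT) f2 addr0 ![qint q _]qint1 // !mulr1.
  have bbf0 : b * b * f 0%N = q^-1 *: (b * f 0%N * b) + b * f 1%N.
    by rewrite -mulrA bf0 mulrDr -scalerAr mulrA bf0.
  rewrite bbf0 bf0 bf1.
  by nc_algebra; field; rewrite ?q0.
(* All powers of [q] are expressed through these two, which turns the verifications into identities
   of rational functions. *)
- pose M := q ^+ N; pose a (n : nat) := q ^+ n.
  have M0 : M != 0 by rewrite expf_neq0.
  have a0 n : a n != 0 by rewrite expf_neq0.
  pose s := (q - q^-1)^-1.
  pose D (n : nat) := a n ^+ 2 / (M * q ^+ 2).
  pose C (n : nat) := d * D n * s ^+ 2 *
     ((a n - (a n)^-1) * (M * q ^+ 3 / a n - a n / (M * q ^+ 3))).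
  have rec' n : (n <= N.+2)%N ->
      b * f n = D n *: (f n * b) + f n.+1 + C n *: f n.-1.
    move=> nN; rewrite rec //.
    have -> : q ^ (n%:Z + n%:Z - N.+2%:Z) = D n.
      rewrite !expfzDr // -!invr_expz -!exprnP /D /a /M expr2; congr (_ * _ / _).
      by rewrite !exprS expr0; ring.
    congr (_ + _ *: _); rewrite /C -[RHS]mulrA; congr (_ * _).
    rewrite !qintE (_ : N.+2%:Z + 1 - n%:Z = N%:Z + 3 - n%:Z); last by lia.
    rewrite !expfzDr // -!invr_expz -!exprnP -/M -/(a n) /s.
    by field; rewrite q0 q2 M0 a0.
  (* The sequence announced above, with [N.+2] for its N. *)
  pose g (n : nat) : A :=
     f n.+2 + (a n ^+ 2 * q ^+ 2 / (M * q ^+ 2) - M * q ^+ 2) *: (f n.+1 * b)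
     - (d * a n ^+ 2 * q ^+ 2 * s ^+ 2 *
     ((M * q ^+ 2 / a n - a n / (M * q ^+ 2)) * (M * q / a n - a n / (M * q)))) *: f n.
  have quad_f : quad q (q * d) N.+2 b (f 0%N) = g 0%N.
    have bf0 := rec' 0%N isT; have bf1 := rec' 1%N isT.
    have C0 : C 0%N = 0 by rewrite /C /a expr0 invr1 subrr mul0r mulr0.
    rewrite /= C0 scale0r addr0 in bf0; rewrite /= in bf1.
    have bbf0 : b * b * f 0%N = D 0%N *: (b * f 0%N * b) + b * f 1%N.
      by rewrite -mulrA bf0 mulrDr -scalerAr mulrA bf0.
    rewrite /quad bbf0 bf0 bf1.
    rewrite qintE -exprnP !exprS -/M /g /C /D /s /a expr0 !exprS expr0.
    by nc_algebra; field; rewrite ?q0 ?q2 ?M0 ?oner_neq0.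
  apply: iser_quad_eq0 => //; rewrite quad_f.
  apply: (IH g) => [n nN|].
    have aS m : a m.+1 = a m * q by rewrite /a exprSr.
    have := rec' n (leqW (leqW nN)); have := rec' n.+1 (leqW nN); have := rec' n.+2 nN.
    rewrite /= => bf2 bf1 bf0.
    rewrite {1}/g mulrBr mulrDr -!scalerAr [b * (_ * b)]mulrA bf2 bf1 bf0.
    rewrite !qintE !expfzDr // -!invr_expz -!exprnP -/M -/(a n) -/s.
    rewrite /g /C /D !aS.
    (* At [n = 0] the predecessor is again [0]; its coefficient vanishes, but the case has to be
       checked separately. *)
    case: n {nN bf0 bf1 bf2} => [|n] /=.
      rewrite /a !expr0.
      by nc_algebra; field; rewrite ?q0 ?q2 ?M0 ?oner_neq0 ?an0.
    rewrite !aS; move: (a n) (a0 n) => an an0.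
    by nc_algebra; field; rewrite ?q0 ?q2 ?M0 ?oner_neq0 ?an0.
  (* Besides [f N.+3 = 0], both coefficients in [g] vanish at [N.+1]. *)
  rewrite /g fN add0r.
  have -> : a N.+1 = M * q by rewrite /a exprSr.
  have -> : (M * q) ^+ 2 * q ^+ 2 / (M * q ^+ 2) - M * q ^+ 2 = 0.
    by field; rewrite q0 M0.
  rewrite [M * q / (M * q) - _]subrr !mulr0.
  by rewrite !scale0r subrr.
Qed.
End Chain.

(** * Iterated q-commutators and q-Serre elements *)

Lemma exp_qcomm (k : pzRingType) (A : algType k) (x y : A) a n :
  x * y = a *: (y * x) -> x ^+ n * y = a ^+ n *: (y * x ^+ n).
Proof.
move=> xy; elim: n => [|n IH]; first by rewrite !expr0 mul1r mulr1 scale1r.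
rewrite exprS -[x * _ * y]mulrA IH -scalerAr (mulrA x) xy -scalerAl scalerA.
by rewrite -(mulrA y) -exprS -exprSr.
Qed.

Section QuantumAdjoint.
Variables (k : fieldType) (q : k).
Hypothesis q_gen : generic q.
Variables (A : algType k) (N : nat).
Implicit Types (x y z : A).

Let q0 := generic_neq0 q_gen.
Let q2 := generic_sqr q_gen.

(** For $x=F_i$, $y=F_j$ and $N=-a_{ij}$, the exponent $2n-N$ is the one with which $K_i^{-1}$
    q-commutes with the [n]-th term. *)
Fixpoint qad x y (n : nat) : A :=
  if n is n'.+1 then
    x * qad x y n' - q ^ (n'%:Z + n'%:Z - N%:Z) *: (qad x y n' * x)
  else y.

Lemma qad_comm x y z n : GRing.comm z x -> GRing.comm z y -> GRing.comm z (qad x y n).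
Proof.
move=> zx zy; elim: n => //= n zn; apply: commrB; first exact: commrM.
by rewrite /GRing.comm -scalerAl -scalerAr (commrM zn zx).
Qed.

Lemma qad_qcomm x y z a b n :
  z * x = a *: (x * z) -> z * y = b *: (y * z) ->
  z * qad x y n = (a ^+ n * b) *: (qad x y n * z).
Proof.
move=> zx zy; elim: n => [|n IH] /=; first by rewrite mul1r.
rewrite mulrBr mulrA zx -scalerAl -mulrA IH -[in X in _ - X]scalerAr mulrA IH.
rewrite -!scalerAr -!scalerAl -mulrA zx exprS.
by nc_algebra; ring.
Qed.

Lemma qbinom0 n : qbinom q n 0 = 1.
Proof. by rewrite /qbinom big_ord0 /qfact big_geq // divr1. Qed.

Lemma qbinomS n d :
  qbinom q n d.+1 = qbinom q n d * qint q (n - d%:Z) / qint q d.+1.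
Proof.
rewrite /qbinom big_ord_recr qfactS /= invfM mulrA; ring.
Qed.

Lemma qbinom_small (n : nat) : qbinom q n n.+1 = 0.
Proof. by rewrite qbinomS subrr qint0 mulr0 mul0r. Qed.

Lemma qbinom_mulS (n : int) (d : nat) :
  qbinom q (n + 1) d.+1 * qint q d.+1 = qint q (n + 1) * qbinom q n d.
Proof.
rewrite /qbinom big_ord_recl qfactS subr0 /=.
rewrite (eq_bigr (fun j : 'I_d => qint q (n - j%:Z))); last first.
  by move=> j _; congr qint; rewrite /bump; lia.
by field; rewrite qfact_neq0 // qint_neq0.
Qed.

Lemma qbinom_pascal (n d : nat) :
  qbinom q n.+1 d.+1 =
    q ^ (d%:Z - n%:Z) * qbinom q n d + q ^ (d.+1%:Z) * qbinom q n d.+1.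
Proof.
apply: (mulIf (@qint_neq0 _ _ q_gen d.+1 _)) => //.
rewrite (_ : n.+1%:Z = n%:Z + 1); last by lia.
rewrite qbinom_mulS qbinomS.
have -> : (q ^ (d%:Z - n%:Z) * qbinom q n d + q ^ d.+1%:Z *
    (qbinom q n d * qint q (n%:Z - d%:Z) / qint q d.+1)) * qint q d.+1 =
    (q ^ (d%:Z - n%:Z) * qint q d.+1 + q ^ d.+1%:Z * qint q (n%:Z - d%:Z)) *
    qbinom q n d.
  by field; rewrite qint_neq0.
congr (_ * _); rewrite !qintE !intS !expfzDr // -!invr_expz -!exprnP expr1.
have := expf_neq0 n q0; have := expf_neq0 d q0.
move: (q ^+ n) (q ^+ d) => a b b0 a0.
by field; rewrite q0 q2 a0 b0.
Qed.

(** Induction by [qbinom_pascal]. At [n = N.+1] the exponent has the factor $n-1-N=0$, so only the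
    q-binomial coefficients remain; this gives [qad_serre]. *)
Lemma qadE x y n : qad x y n = (-1) ^+ n *: \sum_(j < n.+1)
  ((-1) ^+ j * q ^ ((n%:Z - j%:Z) * (n%:Z - 1 - N%:Z)) * qbinom q n j) *:
    (x ^+ j * y * x ^+ (n - j)).
Proof.
elim: n => [|n IH] /=.
  by rewrite big_ord1 !expr0 qbinom0 subrr mul0r expr0z !mulr1 !scale1r mul1r.
pose a (m j : nat) := (-1) ^+ j * q ^ ((m%:Z - j%:Z) * (m%:Z - 1 - N%:Z)) * qbinom q m j.
rewrite {}IH -scalerAr -scalerAl mulr_sumr mulr_suml scalerA mulrC -scalerA.
rewrite -scalerBr exprSr -scalerA scaleN1r; congr (_ *: _).
have -> : \sum_(i < n.+1) x * (a n i *: (x ^+ i * y * x ^+ (n - i))) =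
    \sum_(i < n.+2)
      (if i : nat is i'.+1 then a n i' else 0) *: (x ^+ i * y * x ^+ (n.+1 - i)).
  rewrite [RHS]big_ord_recl scale0r add0r; apply: eq_bigr => i _ /=.
  by rewrite -scalerAr !mulrA -exprS.
have -> : \sum_(i < n.+1) a n i *: (x ^+ i * y * x ^+ (n - i)) * x =
    \sum_(i < n.+2) a n i *: (x ^+ i * y * x ^+ (n.+1 - i)).
  have an : a n n.+1 = 0 by rewrite /a qbinom_small mulr0.
  rewrite [RHS]big_ord_recr /= an scale0r addr0.
  apply: eq_bigr => i _ /=.
  by rewrite -scalerAl -(mulrA _ _ x) -exprSr -subSn ?leq_ord.
rewrite scaler_sumr -sumrB -sumrN; apply: eq_bigr => -[[|j] /= jn] _.
  rewrite scalerA -scalerBl -scaleNr; congr (_ *: _).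
  rewrite /a !qbinom0 sub0r !expr0 !mul1r !mulr1 -expfzDr //; congr (- (_ ^ _)).
  by lia.
rewrite scalerA -scalerBl -scaleNr; congr (_ *: _).
rewrite /a qbinom_pascal exprS.
rewrite (_ : (n.+1%:Z - j.+1%:Z) * (n.+1%:Z - 1 - N%:Z) =
  (n%:Z - j%:Z) * (n%:Z - 1 - N%:Z) + (n%:Z - j%:Z)); last by lia.
rewrite (_ : (n%:Z - j.+1%:Z) * (n%:Z - 1 - N%:Z) =
  (n%:Z - j%:Z) * (n%:Z - 1 - N%:Z) + (N%:Z + 1 - n%:Z)); last by lia.
rewrite !intS !expfzDr // -!invr_expz.
move: (q ^ _) => t.
have := expfz_neq0 n%:Z q0; have := expfz_neq0 j%:Z q0; have := expfz_neq0 N%:Z q0.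
move: (q ^ N%:Z) (q ^ n%:Z) (q ^ j%:Z) => a1 a2 a3 a10 a20 a30.
by rewrite expr1z; field; rewrite a10 a20 a30.
Qed.

Definition qserre x y : A :=
  \sum_(n < N.+2) ((-1) ^+ n * qbinom q N.+1 n) *: (x ^+ n * y * x ^+ (N.+1 - n)).

Lemma qad_serre x y : qad x y N.+1 = (-1) ^+ N.+1 *: qserre x y.
Proof.
rewrite qadE; congr (_ *: _); apply: eq_bigr => j _; congr (_ *: _).
by rewrite (_ : N.+1%:Z - 1 - N%:Z = 0) ?mulr0 ?expr0z ?mulr1 //; lia.
Qed.

Lemma qserre_qad x y : qserre x y = (-1) ^+ N.+1 *: qad x y N.+1.
Proof. by rewrite qad_serre scalerA -expr2 sqrr_sign scale1r. Qed.

Section Commutators.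
Variables (e f g l j : A) (s : k).
Hypothesis lf : l * f = q ^- 2 *: (f * l).
Hypothesis jf : j * f = q ^+ 2 *: (f * j).
Hypothesis lg : l * g = q ^+ N *: (g * l).
Hypothesis jg : j * g = q ^- N *: (g * j).
Hypothesis ef : e * f - f * e = (q - q^-1)^-1 *: (l - j).
Hypothesis eg : e * g = g * e.

(** With $e=E_i$, $f=F_i$, $g=F_j$, the q-commutators form a string of highest weight [N] for
    quantum $sl_2$; hence the coefficient $[n][N+1-n]$, which vanishes at [N.+1]. *)
Lemma comm_qad n : e * qad f g n = qad f g n * e +
  (qint q n * qint q (N%:Z + 1 - n%:Z)) *: (qad f g n.-1 * l).
Proof.
elim: n => [|n IH] /=; first by rewrite [qint q 0%N]qint0 mul0r scale0r addr0.
have efE : e * f = f * e + (q - q^-1)^-1 *: (l - j) by rewrite -ef addrC subrK.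
pose M := q ^+ N; pose a := q ^+ n.
have M0 : M != 0 by rewrite expf_neq0.
have a0 : a != 0 by rewrite expf_neq0.
have lad : l * qad f g n = (M / a ^+ 2) *: (qad f g n * l).
  rewrite (qad_qcomm n lf lg); congr (_ *: _).
  by rewrite -/M mulrC exprVn -exprM mulnC exprM.
have jad : j * qad f g n = (a ^+ 2 / M) *: (qad f g n * j).
  rewrite (qad_qcomm n jf jg); congr (_ *: _).
  by rewrite -/M -exprM mulnC exprM.
have D : q ^ (n%:Z + n%:Z - N%:Z) = a ^+ 2 / M.
  by rewrite !expfzDr // -invr_expz -!exprnP expr2.
rewrite D; set h := qad f g n in IH lad jad *.
have eh : e * (f * h - (a ^+ 2 / M) *: (h * f)) = f * (e * h) +
   (q - q^-1)^-1 *: (l * h - j * h) - (a ^+ 2 / M) *: (e * h * f).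
  by rewrite mulrBr [e * (f * h)]mulrA efE -[in LHS]scalerAr; nc_algebra; ring.
set b := qint q n * _ in IH.
(* After moving [l] to the right the bracket is the recursive definition of [h]; at [n = 0], where
   it is not, the coefficient is $[0]$. *)
have bh : b *: (f * (qad f g n.-1 * l) - (a ^+ 2 / M) *: (qad f g n.-1 * l * f)) =
    b *: (h * l).
  rewrite /h /b /a; case: (n) => [|m] /=.
    by rewrite [qint q 0%N]qint0 mul0r !scale0r.
  congr (_ *: _); rewrite -[_ * l * f]mulrA lf !expfzDr // -invr_expz -!exprnP -/M.
  by rewrite (exprS q m); nc_algebra; field; rewrite ?q0 ?M0.
rewrite eh lad jad IH.
rewrite (_ : _ - _ = f * h * e + (q - q^-1)^-1 *: ((M / a ^+ 2) *: (h * l) -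
   (a ^+ 2 / M) *: (h * j)) - (a ^+ 2 / M) *: (h * (e * f)) +
   b *: (f * (qad f g n.-1 * l) - (a ^+ 2 / M) *: (qad f g n.-1 * l * f))); last first.
  by nc_algebra; ring.
rewrite bh efE /b !qintE (_ : N%:Z + 1 - n.+1%:Z = N%:Z - n%:Z); last by lia.
rewrite intS !expfzDr // -!invr_expz -!exprnP -/M -/a.
by nc_algebra; field; rewrite ?q0 ?q2 ?M0 ?a0.
Qed.

Lemma comm_qserre : GRing.comm e (qserre f g).
Proof.
rewrite qserre_qad /GRing.comm -scalerAr -scalerAl comm_qad.
by rewrite (_ : N%:Z + 1 - N.+1%:Z = 0) ?qint0 ?mulr0 ?scale0r ?addr0 //; lia.
Qed.

End Commutators.

Section CommutatorsBase.
Variables (e f g l j : A) (s : k).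
Hypothesis lf : l * f = q ^+ N *: (f * l).
Hypothesis jf : j * f = q ^- N *: (f * j).
Hypothesis eg : e * g - g * e = s *: (l - j).
Hypothesis ef : e * f = f * e.

(** The case $e=E_j$. The first q-commutator kills the part in [l]; each further one multiplies the
    part in [j] by $q^N-q^{2i-N}$, which is zero for $i=N$. *)
Lemma comm_qserre_base : GRing.comm e (qserre f g).
Proof.
have fl : f * l = q ^- N *: (l * f).
  by rewrite lf scalerA mulVf ?scale1r // expf_neq0.
have fj : f * j = q ^+ N *: (j * f).
  by rewrite jf scalerA divff ?scale1r // expf_neq0.
pose c n := - s * \prod_(0 <= i < n.+1) (q ^+ N - q ^ (i%:Z + i%:Z - N%:Z)).
have step t h : e * (f * h - t *: (h * f)) - (f * h - t *: (h * f)) * e =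
    f * (e * h - h * e) - t *: ((e * h - h * e) * f).
  rewrite (_ : _ - _ = (e * f) * h - t *: (e * h * f) - f * h * e + t *: (h * (f * e))).
    have -> : e * f * h = f * (e * h) by rewrite ef mulrA.
    by rewrite -ef; nc_algebra; ring.
  by nc_algebra; ring.
have key n : e * qad f g n.+1 - qad f g n.+1 * e = c n *: (j * f ^+ n.+1).
  elim: n => [|n IH].
    rewrite [qad _ _ _]/= step eg /c big_nat1 /= sub0r -invr_expz -exprnP expr1.
    by rewrite -scalerAr -scalerAl mulrBl mulrBr fl fj; nc_algebra; ring.
  rewrite [qad _ _ _]/= step IH /c [in RHS]big_nat_recr //=.
  rewrite -scalerAr mulrA fj -!scalerAl -!mulrA -exprS -exprSr.
  by move: (j * f ^+ n.+2) => h; nc_algebra; ring.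
rewrite /GRing.comm qserre_qad -scalerAr -scalerAl; congr (_ *: _).
apply/eqP; rewrite -subr_eq0 key /c big_nat_recr //= (_ : q ^ _ = q ^+ N).
  by rewrite subrr mulr0 mulr0 scale0r.
by rewrite exprnP; congr (_ ^ _); lia.
Qed.
End CommutatorsBase.
End QuantumAdjoint.

(** * Rank one: elements annihilated by the i-Serre operator *)

Section RankOne.
Variables (k : fieldType) (q : k).
Hypothesis q_gen : generic q.
Variables (A : algType k) (d kap : k) (x y j : A).
Local Notation s := (q - q^-1)^-1.

Hypothesis yx : y * x = q ^+ 2 *: (x * y) + (q ^+ 2 * d * s) *: (1 - j * j).
Hypothesis jx : j * x = q ^+ 2 *: (x * j).

Local Notation b := (x + y + kap *: j).
Let q0 := generic_neq0 q_gen.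
Let q2 := generic_sqr q_gen.

(** On the chain of q-commutators of [x] with [g], [x] raises the index, [y] lowers it and [j]
    preserves it. All three pass the [n]-th term with the same factor $q^{2n-N}$, so their
    combination [b] satisfies the recurrence of [iser_chain]. *)
Lemma iser_qad r N g :
  j * g = q ^- N *: (g * j) -> y * g = q ^- N *: (g * y) ->
  qad q N x g N.+1 = 0 -> iser q (q * d) r N.+1 b g = 0.
Proof.
move=> jg yg gN; pose M := q ^+ N; pose h := qad q N x g.
have M0 : M != 0 by rewrite expf_neq0.
have D n : q ^ (n%:Z + n%:Z - N%:Z) = (q ^+ n) ^+ 2 / M.
  by rewrite !expfzDr // -invr_expz -!exprnP expr2.
have jh n : j * h n = ((q ^+ n) ^+ 2 / M) *: (h n * j).
  by rewrite (qad_qcomm q N n jx jg) -/M -exprM mulnC exprM.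
have hS n : h n.+1 = x * h n - ((q ^+ n) ^+ 2 / M) *: (h n * x).
  by rewrite -D.
have yh n : y * h n = ((q ^+ n) ^+ 2 / M) *: (h n * y) +
   (d * ((q ^+ n) ^+ 2 / M) * (qint q n * qint q (N%:Z + 1 - n%:Z))) *: h n.-1.
  elim: n => [|n IH].
    rewrite [qint q 0%N]qint0 mul0r mulr0 scale0r addr0 expr0 expr1n mul1r.
    exact: yg.
  set p := qint q n * _ in IH.
  have ph : p *: (x * h n.-1 - ((q ^+ n) ^+ 2 / q ^+ 2 / M) *: (h n.-1 * x)) =
      p *: h n.
    case: (n) @p {IH} => [|m] p /=; first by rewrite /p [qint q 0%N]qint0 mul0r !scale0r.
    rewrite hS (exprS q m); by congr (_ *: (_ - _ *: _)); field; rewrite ?q0 ?M0.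
  pose a := q ^+ n; have a0 : a != 0 by rewrite expf_neq0.
  have jjh : j * (j * h n) = ((a ^+ 2 / M) ^+ 2) *: (h n * j * j).
    by rewrite jh -/a -scalerAr mulrA jh -/a -scalerAl scalerA -expr2.
  rewrite {1}hS -/a.
  have -> : y * (x * h n - (a ^+ 2 / M) *: (h n * x)) =
      q ^+ 2 *: (x * (y * h n)) + (q ^+ 2 * d * s) *: (h n - j * (j * h n)) -
      (a ^+ 2 / M) *: (y * h n * x).
    by rewrite mulrBr [y * (x * _)]mulrA yx; nc_algebra; ring.
  rewrite jjh IH -/a.
  set c := d * _ * p.
  have -> : ((a ^+ 2 / M) *: (h n * y) + c *: h n.-1) * x =
      (a ^+ 2 / M) *: (h n * (y * x)) + c *: (h n.-1 * x).
    by nc_algebra; ring.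
  rewrite yx.
  have -> : q ^+ 2 *: (x * ((a ^+ 2 / M) *: (h n * y) + c *: h n.-1)) +
     (q ^+ 2 * d * s) *: (h n - (a ^+ 2 / M) ^+ 2 *: (h n * j * j)) -
     (a ^+ 2 / M) *: ((a ^+ 2 / M) *: (h n * (q ^+ 2 *: (x * y) +
       (q ^+ 2 * d * s) *: (1 - j * j))) + c *: (h n.-1 * x)) =
     (q ^+ 2 * (a ^+ 2 / M)) *: (h n.+1 * y) +
     (q ^+ 2 * d * (a ^+ 2 / M)) *:
         (p *: (x * h n.-1 - (a ^+ 2 / q ^+ 2 / M) *: (h n.-1 * x))) +
     (q ^+ 2 * d * s * (1 - (a ^+ 2 / M) ^+ 2)) *: h n.
    by rewrite hS /c -/a; nc_algebra; field; rewrite ?q0 ?q2 ?M0.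
  rewrite ph (exprS q n) -/a /p !qintE.
  rewrite (_ : N%:Z + 1 - n.+1%:Z = N%:Z - n%:Z); last by lia.
  rewrite intS !expfzDr // -!invr_expz -!exprnP -/M -/a.
  by rewrite succnK; nc_algebra; field; rewrite ?q0 ?q2 ?M0 ?a0.
apply: (iser_chain q_gen r (f := h)) => // n nN.
rewrite !mulrDl -scalerAl yh jh D hS.
by nc_algebra; field; rewrite ?q0 ?M0.
Qed.

(* With x = F, y = d E K^-1 and j = K^-1, this is d K^-1 times the Casimir
   element, so that it q-commutes with x and y in the same way as j. *)
Definition om := x * y + (d * s ^+ 2) *: (q *: 1 + q^-1 *: (j * j)).

Hypothesis yj : y * j = q ^+ 2 *: (j * y).

Let r1 : y * x - (q ^+ 2 *: (x * y) + (q ^+ 2 * d * s) *: (1 - j * j)) = 0.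
Proof. by rewrite yx subrr. Qed.
Let r2 : j * x - q ^+ 2 *: (x * j) = 0.
Proof. by rewrite jx subrr. Qed.
Let r3 : y * j - q ^+ 2 *: (j * y) = 0.
Proof. by rewrite yj subrr. Qed.

Let x_om : x * om = q ^- 2 *: (om * x).
Proof.
apply/eqP; rewrite -subr_eq0; apply/eqP; rewrite /om.
transitivity (- q ^- 2 *:
  (x * (y * x - (q ^+ 2 *: (x * y) + (q ^+ 2 * d * s) *: (1 - j * j)))) -
  (d * s ^+ 2 * q ^- 3) *: (j * (j * x - q ^+ 2 *: (x * j)) +
     q ^+ 2 *: ((j * x - q ^+ 2 *: (x * j)) * j))).
  by nc_algebra; field; rewrite ?q0 ?q2.
by rewrite r1 r2 !(mulr0, mul0r, scaler0, addr0, subr0).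
Qed.

Let y_om : y * om = q ^+ 2 *: (om * y).
Proof.
apply/eqP; rewrite -subr_eq0; apply/eqP; rewrite /om.
transitivity (
  (y * x - (q ^+ 2 *: (x * y) + (q ^+ 2 * d * s) *: (1 - j * j))) * y +
  (d * s ^+ 2 * q ^- 1) *: ((y * j - q ^+ 2 *: (j * y)) * j +
     q ^+ 2 *: (j * (y * j - q ^+ 2 *: (j * y))))).
  by nc_algebra; field; rewrite ?q0 ?q2.
by rewrite r1 r3 !(mulr0, mul0r, scaler0, addr0).
Qed.

Let j_om : j * om = om * j.
Proof.
apply/eqP; rewrite -subr_eq0; apply/eqP; rewrite /om.
transitivity ((j * x - q ^+ 2 *: (x * j)) * y - x * (y * j - q ^+ 2 *: (j * y))).
  by nc_algebra; field; rewrite ?q0 ?q2.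
by rewrite r2 r3 !(mulr0, mul0r, subr0).
Qed.

(** The q-commutation rules of a power of $K_i$. The element [j] has $t=q^{-2}$, and $K_j^{-1}$ has
    $t=q_i^{-a_{ij}}$. *)
Definition scalar_like (t : k) (z : A) : Prop :=
  [/\ x * z = t *: (z * x), y * z = t^-1 *: (z * y) & j * z = z * j].

Let al (t : k) := (1 - t ^+ 2) + q ^+ 2 * (1 - t ^- 2).
Let ep (t ga de : k) := kap ^+ 2 * (2 - t - t^-1) - ga * kap - de * kap -
   d * s ^+ 2 * (q^-1 * (1 - t ^+ 2) + q ^+ 3 * (1 - t ^- 2)).

Lemma quad_scalar_like n z ga de : let t := q ^+ n in
  scalar_like t z ->
  ga * t * q ^- 2 + de = kap * (1 - t) * (t * q ^- 2 - t^-1) ->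
  ga * q ^+ 2 / t + de = kap * (1 - t^-1) * (q ^+ 2 / t - t) ->
  quad q (q * d) n b z = al t *: (z * om) + ga *: (b * (z * j)) +
    de *: (z * j * b) + ep t ga de *: (z * j * j).
Proof.
move=> t [xz yz jz] gade1 gade2.
have t0 : t != 0 by rewrite expf_neq0.
pose b1 := t *: x + t^-1 *: y + kap *: j.
have bz : b * z = z * b1.
  by rewrite /b1 !mulrDl xz yz -scalerAl jz; nc_algebra; ring.
rewrite /quad [b * (z * j)]mulrA -[b * b * z]mulrA bz mulrA bz.
have -> : q ^+ n = t by [].
rewrite qintE -exprnP -/t.
have xE : ga = (kap * (1 - t) * (t * q ^- 2 - t^-1) - de) * q ^+ 2 / t.
  by rewrite -gade1; field; rewrite q0 t0.
apply/eqP; rewrite -subr_eq0; apply/eqP.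
transitivity (z * (
  (1 - t ^- 2) *: (y * x - (q ^+ 2 *: (x * y) + (q ^+ 2 * d * s) *: (1 - j * j)))
  + (kap * (1 - t^-1) - de) *: (j * x - q ^+ 2 *: (x * j))
  + (kap * (t^-1 - t ^- 2) - ga * t^-1) *: (y * j - q ^+ 2 *: (j * y)))).
  rewrite /b1 /al /ep /om.
  nc_algebra; try by field; rewrite ?q0 ?q2 ?t0.
  - transitivity (- q ^+ 2 * ((ga * t * q ^- 2 + de) -
        kap * (1 - t) * (t * q ^- 2 - t^-1))).
      by field; rewrite ?q0 ?t0.
    by rewrite gade1 subrr mulr0.
  - transitivity (- ((ga * q ^+ 2 / t + de) - kap * (1 - t^-1) * (q ^+ 2 / t - t))).
      by field; rewrite ?q0 ?t0.
    by rewrite gade2 subrr oppr0.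
by rewrite r1 r2 r3 !scaler0 !addr0 mulr0.
Qed.

Let scalar_like_om t z : scalar_like t z -> scalar_like (t * q ^- 2) (z * om).
Proof.
case=> xz yz jz; split.
- by rewrite (mulrA x) xz -scalerAl -(mulrA z x) x_om -scalerAr scalerA (mulrA z).
- rewrite (mulrA y) yz -scalerAl -(mulrA z y) y_om -scalerAr scalerA (mulrA z).
  congr (_ *: _).
  by rewrite invfM invrK.
- by rewrite (mulrA j) jz -!(mulrA z) j_om.
Qed.

Let scalar_like_j t z : scalar_like t z -> scalar_like (t * q ^- 2) (z * j).
Proof.
have xj : x * j = q ^- 2 *: (j * x).
  by rewrite jx scalerA mulVf ?scale1r // expf_neq0.
case=> xz yz jz; split.
- by rewrite (mulrA x) xz -scalerAl -(mulrA z x) xj -scalerAr scalerA (mulrA z).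
- rewrite (mulrA y) yz -scalerAl -(mulrA z y) yj -scalerAr scalerA (mulrA z).
  congr (_ *: _).
  by rewrite invfM invrK.
- by rewrite (mulrA j) jz.
Qed.

(** Both operators are built from left and right multiplications by polynomials in [b], and these
    commute. *)
Lemma iser_quad_comm c r m n z :
  iser q c r m b (quad q c n b z) = quad q c n b (iser q c r m b z).
Proof.
have bb : GRing.comm b b by [].
have iserB u v : iser q c r m b (u - v) = iser q c r m b u - iser q c r m b v.
  by rewrite iserD -scaleN1r iserZ scaleN1r.
have bb2 : GRing.comm (b * b) b by rewrite /GRing.comm mulrA.
rewrite /quad !(iserB, iserD, iserZ) (iser_comm_l _ _ _ _ _ bb2).
by rewrite !(iser_comm_r _ _ _ _ _ bb) (iser_comm_r _ _ _ _ _ bb2)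
  (iser_comm_l _ _ _ _ _ bb).
Qed.

(** A quadratic operator lowers the length by 2 and the exponent of [z * om] and [z * j] by 2, but
    that of [z * j * j] by 4. For the last term a further [quad] is split off and moved past [iser],
    whence an induction over two consecutive cases. *)
Lemma iser_scalar_like r m z : scalar_like (q ^+ m.*2) z ->
  iser q (q * d) r m.*2.+1 b z = 0.
Proof.
move: z; suff: (forall z, scalar_like (q ^+ m.*2) z -> iser q (q * d) r m.*2.+1 b z = 0)
  /\ (forall z, scalar_like (q ^+ m.*2.+2) z -> iser q (q * d) r m.*2.+3 b z = 0).
  by case.
have bb : GRing.comm b b by [].
have comm1 w : scalar_like 1 w -> w * b - b * w = 0.
  case=> xw yw jw; rewrite !mulrDr !mulrDl xw yw -scalerAr -scalerAl jw.
  by rewrite invr1 !scale1r subrr.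
elim: m => [|m [IH1 IH2]].
  split=> z zP; first by rewrite iser1 // comm1.
  have om1 : scalar_like 1 (z * om).
    by have := scalar_like_om zP; rewrite divff // expf_neq0.
  have j1 : scalar_like 1 (z * j).
    by have := scalar_like_j zP; rewrite divff // expf_neq0.
  apply: iser_quad_eq0 => //.
  (* At $t=q^2$ the linear system for [ga] and [de] is degenerate and 0 is an admissible [ga]. The
     coefficient [ep] vanishes there, which removes [z * j * j], whose parameter would be
     $q^{-2}$. *)
  rewrite (@quad_scalar_like _ _ 0
    (kap * (1 - q ^+ 2) * (q ^+ 2 * q ^- 2 - q ^- 2)) zP); last first.
  - by field; rewrite q0.
  - by rewrite !mul0r add0r.
  rewrite (_ : ep _ _ _ = 0); last by rewrite /ep; field; rewrite q0 q2.
  rewrite !scale0r !addr0 iserD !iserZ (iser_comm_r _ _ _ _ _ bb) !iser1 //.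
  by rewrite !comm1 // mul0r !scaler0 addr0.
split=> // z zP.
apply: iser_quad_eq0 => //.
pose u := q ^+ m.*2.+2.
have u0 : u != 0 by rewrite expf_neq0.
have u2 : u * u - 1 != 0.
  by rewrite -exprD addSn subr_eq0; case: q_gen => _; apply.
have tE : q ^+ m.+1.*2.+2 = u * q ^+ 2 by rewrite -exprD addn2.
(* With $t=uq^2$ the system has determinant $u-u^{-1}\neq0$; this is its solution. *)
pose ga := kap * ((1 - u * q ^+ 2) * (u - (u * q ^+ 2)^-1) -
   (1 - (u * q ^+ 2)^-1) * (u^-1 - u * q ^+ 2)) / (u - u^-1).
rewrite (@quad_scalar_like _ _ ga
  (kap * (1 - u * q ^+ 2) * (u - (u * q ^+ 2)^-1) - ga * u) zP); last first.
- by rewrite tE /ga; field; rewrite q0 u0 u2.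
- by rewrite tE; field; rewrite q0 u0.
have zom : scalar_like (q ^+ m.*2.+2) (z * om).
  by have := scalar_like_om zP; rewrite tE mulfK ?expf_neq0.
have zj : scalar_like (q ^+ m.*2.+2) (z * j).
  by have := scalar_like_j zP; rewrite tE mulfK ?expf_neq0.
have zjj : scalar_like (q ^+ m.*2) (z * j * j).
  by have := scalar_like_j zj; rewrite -addn2 exprD mulfK ?expf_neq0.
rewrite !(iserD, iserZ) (IH2 _ zom) scaler0 add0r.
rewrite (iser_comm_l _ _ _ _ _ bb) (iser_comm_r _ _ _ _ _ bb) (IH2 _ zj).
rewrite mulr0 mul0r !scaler0 !add0r iser_quad_eq0 ?scaler0 //.
by rewrite iser_quad_comm (IH1 _ zjj) /quad !(mulr0, mul0r, scaler0, oppr0, addr0).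
Qed.

End RankOne.

(** * Endomorphisms and free algebras *)

Section Endomorphisms.
Variables (R : fieldType) (V : lalgType R).

Definition endo_pred : pred (V -> V) := fun f => `[< linear f >].
(** Bundled as an algebra so that identities proved in an arbitrary algebra apply to operators. The
    unit of [V] serves to show that the identity is not zero. *)
Record endo := Endo { endo_fun :> V -> V; endo_funP : endo_pred endo_fun }.

HB.instance Definition _ := [isSub for endo_fun].
HB.instance Definition _ := [Choice of endo by <:].

Lemma endoP (f g : endo) : f =1 g -> f = g.
Proof. by move=> fg; apply: val_inj; apply: funext. Qed.

Lemma endo_linear (f : endo) : linear f.
Proof. exact/asboolP/endo_funP. Qed.

HB.instance Definition _ (f : endo) :=
  GRing.isLinear.Build R V V *:%R (endo_fun f) (endo_linear f).

Definition linear_endo (f : {linear V -> V}) : endo :=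
  Endo (introT (asboolP (linear f)) (linearP f)).

Definition endo0 := linear_endo \0.
Definition endo1 := linear_endo idfun.
Definition endo_opp (f : endo) : endo := linear_endo (\- f).
Definition endo_add (f g : endo) : endo := linear_endo (f \+ g).
Definition endo_mul (f g : endo) : endo := linear_endo (f \o g).
Fact endo_scale_linear a (f : endo) : linear (fun v => a *: f v).
Proof. by move=> b u v; rewrite linearP scalerDr !scalerA mulrC. Qed.
Definition endo_scale a (f : endo) : endo :=
  Endo (introT (asboolP _) (endo_scale_linear a f)).

Fact endo_addA : associative endo_add.
Proof. by move=> f g h; apply: endoP => v /=; rewrite addrA. Qed.
Fact endo_addC : commutative endo_add.
Proof. by move=> f g; apply: endoP => v /=; rewrite addrC. Qed.
Fact endo_add0 : left_id endo0 endo_add.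
Proof. by move=> f; apply: endoP => v /=; rewrite add0r. Qed.
Fact endo_addN : left_inverse endo0 endo_opp endo_add.
Proof. by move=> f; apply: endoP => v /=; rewrite addNr. Qed.
HB.instance Definition _ :=
  GRing.isZmodule.Build endo endo_addA endo_addC endo_add0 endo_addN.

Fact endo_mulA : associative endo_mul.
Proof. by move=> f g h; apply: endoP. Qed.
Fact endo_mul1l : left_id endo1 endo_mul.
Proof. by move=> f; apply: endoP. Qed.
Fact endo_mul1r : right_id endo1 endo_mul.
Proof. by move=> f; apply: endoP. Qed.
Fact endo_mulDl : left_distributive endo_mul endo_add.
Proof. by move=> f g h; apply: endoP. Qed.
Fact endo_mulDr : right_distributive endo_mul endo_add.
Proof. by move=> f g h; apply: endoP => v /=; rewrite linearD. Qed.
Fact endo_1neq0 : endo1 != 0.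
Proof.
by apply/eqP => /(congr1 (fun f : endo => f 1)) /= /eqP; rewrite oner_eq0.
Qed.
HB.instance Definition _ := GRing.Zmodule_isNzRing.Build endo
  endo_mulA endo_mul1l endo_mul1r endo_mulDl endo_mulDr endo_1neq0.

Fact endo_scaleA a b f : endo_scale a (endo_scale b f) = endo_scale (a * b) f.
Proof. by apply: endoP => v /=; rewrite scalerA. Qed.
Fact endo_scale1 : left_id 1 endo_scale.
Proof. by move=> f; apply: endoP => v /=; rewrite scale1r. Qed.
Fact endo_scaleDr : right_distributive endo_scale +%R.
Proof. by move=> a f g; apply: endoP => v /=; rewrite scalerDr. Qed.
Fact endo_scaleDl f : {morph endo_scale^~ f : a b / a + b}.
Proof. by move=> a b; apply: endoP => v /=; rewrite scalerDl. Qed.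
HB.instance Definition _ := GRing.Zmodule_isLmodule.Build R endo
  endo_scaleA endo_scale1 endo_scaleDr endo_scaleDl.

Fact endo_scaleAl a (f g : endo) : a *: (f * g) = (a *: f) * g.
Proof. by apply: endoP. Qed.
HB.instance Definition _ := GRing.Lmodule_isLalgebra.Build R endo endo_scaleAl.
Fact endo_scaleAr a (f g : endo) : a *: (f * g) = f * (a *: g).
Proof. by apply: endoP => v /=; rewrite linearZ. Qed.
HB.instance Definition _ := GRing.Lalgebra_isAlgebra.Build R endo endo_scaleAr.

Lemma endoZ (f : endo) a v : f (a *: v) = a *: f v. Proof. exact: linearZ. Qed.
Lemma endoD (f : endo) u v : f (u + v) = f u + f v. Proof. exact: linearD. Qed.
Lemma endo_fun0 (f : endo) : f 0 = 0. Proof. exact: linear0. Qed.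
Lemma endo_mulE (f g : endo) v : (f * g) v = f (g v). Proof. by []. Qed.
Lemma endo_addE (f g : endo) v : (f + g) v = f v + g v. Proof. by []. Qed.
Lemma endo_oppE (f : endo) v : (- f) v = - f v. Proof. by []. Qed.
Lemma endo_scaleE a (f : endo) v : (a *: f) v = a *: f v. Proof. by []. Qed.
Lemma endo_oneE v : (1 : endo) v = v. Proof. by []. Qed.
Lemma endo_zeroE v : (0 : endo) v = 0. Proof. by []. Qed.

End Endomorphisms.

Lemma mulr_linl (R : pzRingType) (A : lalgType R) a (x y z : A) :
  (a *: x + y) * z = a *: (x * z) + y * z.
Proof. by rewrite mulrDl scalerAl. Qed.

Lemma mulr_linr (R : pzRingType) (A : algType R) a (x y z : A) :
  z * (a *: x + y) = a *: (z * x) + z * y.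
Proof. by rewrite mulrDr scalerAr. Qed.

(* Locked because unification would otherwise unfold it when looking for words. *)
HB.lock Definition fword (R : fieldType) (G : choiceType) (s : seq G) : free_alg R G :=
  \prod_(x <- s) fvar x.

Section FreeAlgebra.
Variables (R : fieldType) (G : choiceType).
Local Notation FA := (free_alg R G).

Fact free_alg_scaleAr (a : R) (u v : FA) : a *: (u * v) = u * (a *: v).
Proof.
have mulC (w : FA) : w * malgC a = malgC a * w.
  rewrite (monalgE w) mulr_suml mulr_sumr; apply: eq_bigr => m _.
  rewrite !malgM_def !fgmulUU mul1m mulm1; congr (mkmalgU _ _); exact: mulrC.
by rewrite -!mul_malgC !mulrA mulC.
Qed.
HB.instance Definition _ :=
  GRing.Lalgebra_isAlgebra.Build R (free_alg R G) free_alg_scaleAr.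

Local Notation fword := (@fword R G).

Lemma fword_nil : fword [::] = 1. Proof. by rewrite fword.unlock big_nil. Qed.
Lemma fword_cons x s : fword (x :: s) = fvar x * fword s.
Proof. by rewrite fword.unlock big_cons. Qed.
Lemma fword_cat s t : fword (s ++ t) = fword s * fword t.
Proof. by rewrite fword.unlock big_cat. Qed.

Lemma fwordE (m : {fmonom G}) : << m >> = fword m :> FA.
Proof.
case: m => s; rewrite /=; elim: s => [|x s IH].
  by rewrite fword_nil -fmoneE.
rewrite fword_cons -IH /fvar malgM_def fgmulUU mulr1 /mmul /=.
by rewrite fmmulE fmuE.
Qed.

Lemma free_algE (u : FA) : u = \sum_(m <- msupp u) u@_m *: fword m.
Proof.
rewrite {1}(monalgE u); apply: eq_bigr => m _.
rewrite -fwordE -mul_malgC malgM_def fgmulUU mulr1; congr << _ *g _ >>.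
by rewrite mul1m.
Qed.

Lemma free_alg_ind (P : FA -> Prop) :
  P 0 -> (forall a s u, P u -> P (a *: fword s + u)) -> forall u, P u.
Proof. by move=> P0 Pw u; rewrite (free_algE u); elim/big_rec: _ => // m v _ /Pw. Qed.

Section Extension.
Variables (V : lmodType R) (phi : seq G -> V).

Definition fext (u : FA) : V := \sum_(m <- msupp u) u@_m *: phi m.

Lemma fext_widen (d : {fset {fmonom G}}) u : (msupp u `<=` d)%fset ->
  fext u = \sum_(m <- d) u@_m *: phi m.
Proof.
move=> ud; rewrite /fext (big_fsetID _ (mem (msupp u)) d) /=.
rewrite [X in _ + X]big1_fset ?addr0; last first.
  move=> m; rewrite !inE /= => /andP[_ mu] _.
  by rewrite mcoeff_outdom ?scale0r.
apply: eq_fbigl => m; rewrite !inE /=.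
by case: (boolP (m \in msupp u)) => [/(fsubsetP ud)->|]; rewrite ?andbF.
Qed.

Fact fext_linear : linear fext.
Proof.
move=> a u v; pose d := (msupp (a *: u + v) `|` (msupp u `|` msupp v))%fset.
have [wd ud vd] : [/\ msupp (a *: u + v) `<=` d, msupp u `<=` d & msupp v `<=` d]%fset.
  by split; apply/fsubsetP => m; rewrite !inE => ->; rewrite ?orbT.
rewrite !(@fext_widen d) //.
rewrite scaler_sumr -big_split; apply: eq_bigr => m _.
by rewrite mcoeffD mcoeffZ scalerDl scalerA.
Qed.
HB.instance Definition _ := GRing.isLinear.Build R FA V *:%R fext fext_linear.

Lemma fext_word s : fext (fword s) = phi s.
Proof.
by rewrite -[s]/(FMonom s : seq G) -fwordE /fext msuppU1 big_seq_fset1 mcoeffUU scale1r.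
Qed.

End Extension.

Lemma linear_fext_eq (V : lmodType R) (f g : {linear FA -> V}) :
  (forall s, f (fword s) = g (fword s)) -> f =1 g.
Proof.
by move=> fg; elim/free_alg_ind => [|a s u fgu]; rewrite ?linear0 // !linearP fg fgu.
Qed.

Section Evaluation.
Variables (A : algType R) (g : G -> A).
Local Notation ev := (free_eval g).

Lemma free_evalE : ev =1 fext (fun s => \prod_(x <- s) g x).
Proof.
move=> u; rewrite /free_eval /mmap /fext; apply: eq_bigr => m _.
by rewrite mulr_algl.
Qed.

Fact free_eval_linear : linear ev.
Proof. by move=> a u v; rewrite !free_evalE linearP. Qed.
HB.instance Definition _ := GRing.isLinear.Build R FA A *:%R ev free_eval_linear.

Lemma free_eval_word s : ev (fword s) = \prod_(x <- s) g x.
Proof. by rewrite free_evalE fext_word. Qed.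

Fact free_eval_monoid : monoid_morphism ev.
Proof.
split=> [|u v]; first by rewrite -fword_nil free_eval_word big_nil.
elim/free_alg_ind: u => [|a s u IHu]; first by rewrite mul0r linear0 mul0r.
have -> : (a *: fword s + u) * v = a *: (fword s * v) + u * v by exact: mulr_linl.
apply: (etrans (free_eval_linear a _ _)).
apply: (etrans _ (congr1 (fun w => w * ev v) (esym (free_eval_linear a _ _)))).
apply: (etrans _ (esym (mulr_linl _ _ _ _))).
apply: congr2 IHu; congr (_ *: _) => {u}.
elim/free_alg_ind: v => [|b t v IHv]; first by rewrite mulr0 linear0 mulr0.
have -> : fword s * (b *: fword t + v) = b *: (fword s * fword t) + fword s * v.
  exact: mulr_linr.
apply: (etrans (free_eval_linear b _ _)).
apply: (etrans _ (congr1 (fun w => ev (fword s) * w) (esym (free_eval_linear b _ _)))).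
apply: (etrans _ (esym (mulr_linr _ _ _ _))).
apply: congr2 IHv; congr (_ *: _) => {v}; rewrite -fword_cat.
by rewrite !free_eval_word big_cat.
Qed.
HB.instance Definition _ :=
  GRing.isMonoidMorphism.Build FA A ev free_eval_monoid.

Lemma free_eval0 : ev 0 = 0. Proof. exact: linear0. Qed.
Lemma free_eval1 : ev 1 = 1. Proof. exact: rmorph1. Qed.
Lemma free_evalD u v : ev (u + v) = ev u + ev v. Proof. exact: linearD. Qed.
Lemma free_evalB u v : ev (u - v) = ev u - ev v. Proof. exact: linearB. Qed.
Lemma free_evalZ a u : ev (a *: u) = a *: ev u. Proof. exact: linearZ. Qed.
Lemma free_evalM u v : ev (u * v) = ev u * ev v. Proof. exact: rmorphM. Qed.
Lemma free_evalX u n : ev (u ^+ n) = ev u ^+ n. Proof. exact: rmorphXn. Qed.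

Lemma free_evalB_eq0 u v a : ev u = a -> ev v = a -> ev (u - v) = 0.
Proof. by rewrite free_evalB => -> ->; rewrite subrr. Qed.
Lemma free_evalM_eq u v a b : ev u = a -> ev v = b -> ev (u * v) = a * b.
Proof. by rewrite free_evalM => -> ->. Qed.
Lemma free_evalZ_eq c u a : ev u = a -> ev (c *: u) = c *: a.
Proof. by rewrite free_evalZ => ->. Qed.
Lemma free_evalB_eq u v a b : ev u = a -> ev v = b -> ev (u - v) = a - b.
Proof. by rewrite free_evalB => -> ->. Qed.
Lemma free_evalX_eq u n a : ev u = a -> ev (u ^+ n) = a ^+ n.
Proof. by rewrite free_evalX => ->. Qed.

Lemma free_eval_sum (J : Type) (r : seq J) (P : pred J) (h : J -> FA) :
  ev (\sum_(i <- r | P i) h i) = \sum_(i <- r | P i) ev (h i).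
Proof. exact: raddf_sum. Qed.
Lemma free_eval_prod (J : Type) (r : seq J) (P : pred J) (h : J -> FA) :
  ev (\prod_(i <- r | P i) h i) = \prod_(i <- r | P i) ev (h i).
Proof. exact: rmorph_prod. Qed.

Lemma free_eval_var x : ev (fvar x) = g x.
Proof. by rewrite -[fvar x]mulr1 -fword_nil -fword_cons free_eval_word big_seq1. Qed.

End Evaluation.

Lemma free_eval_comp (A B : algType R) (f : A -> B) (g : G -> A) u :
  linear f -> monoid_morphism f -> f (free_eval g u) = free_eval (f \o g) u.
Proof.
move=> fP [f1 fM].
elim/free_alg_ind: u => [|a s u IHu].
  by rewrite !free_eval0 -(subrr 0) -{1}(scaleN1r 0) addrC fP scaleN1r addNr.
rewrite !free_eval_linear fP IHu !free_eval_word; congr (_ *: _ + _).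
by elim/big_rec2: _ => // i x y _ <-; rewrite fM.
Qed.

Lemma eq_free_eval (A : algType R) (g h : G -> A) : g =1 h ->
  free_eval g =1 free_eval h.
Proof.
move=> gh u; rewrite !free_evalE; apply: eq_bigr => m _; congr (_ *: _).
exact: eq_bigr.
Qed.

Section Ideals.
Variable rel : FA -> Prop.

Lemma ideal_of_rel r : rel r -> ideal_of rel r.
Proof. by move=> /(ideal_ofM 1 1); rewrite mul1r mulr1. Qed.

Lemma ideal_ofMl u v : ideal_of rel v -> ideal_of rel (u * v).
Proof.
elim=> [|v1 v2 _ IH1 _ IH2|a r b rr]; first by rewrite mulr0; constructor.
  by rewrite mulrDr; constructor.
by rewrite !mulrA; apply: ideal_ofM.
Qed.

Lemma ideal_ofMr u v : ideal_of rel v -> ideal_of rel (v * u).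
Proof.
elim=> [|v1 v2 _ IH1 _ IH2|a r b rr]; first by rewrite mul0r; constructor.
  by rewrite mulrDl; constructor.
by rewrite -mulrA; apply: ideal_ofM.
Qed.

Lemma ideal_ofZ a v : ideal_of rel v -> ideal_of rel (a *: v).
Proof. by move=> /(ideal_ofMl a%:A); rewrite mulr_algl. Qed.

Lemma free_eval_ideal (A : algType R) (g : G -> A) u :
  (forall r, rel r -> free_eval g r = 0) -> ideal_of rel u -> free_eval g u = 0.
Proof.
move=> grel; elim=> [|v1 v2 _ IH1 _ IH2|a r b /grel rr]; first exact: free_eval0.
  by rewrite free_evalD IH1 IH2 addr0.
by rewrite !free_evalM rr mulr0 mul0r.
Qed.

End Ideals.
End FreeAlgebra.

(** * The quantum group relations *)

Lemma qq_generic (K : fieldType) : generic (qq K).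
Proof.
split=> [|n]; rewrite /qq; first by rewrite tofrac_eq0 polyX_eq0.
rewrite -tofracXn -tofrac1 tofrac_eq.
apply/eqP => /(congr1 (fun p : {poly K} => size p)).
by rewrite size_polyXn size_poly1.
Qed.

Lemma genericX (k : fieldType) (q : k) n : generic q -> generic (q ^+ n.+1).
Proof.
by case=> q0 q1; split=> [|m]; [rewrite expf_neq0 | rewrite -exprM mulnS q1].
Qed.

Section CartanDatum.
Variables (K : fieldType) (I : finType) (C : cartan_datum I).
Local Notation q := (qq K).

Definition serre_exp (i j : I) : nat := `|cartan C i j|%N.

Lemma eps_gt0 i : (0 < eps C i)%N.
Proof. by rewrite /eps; have [n ->] := dot_diag C i; rewrite mulKz; lia. Qed.

Lemma dot_diagE i : dot C i i = 2 * (eps C i)%:Z.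
Proof. by rewrite /eps; have [n ->] := dot_diag C i; rewrite mulKz. Qed.

Lemma dot_eps_cartan i j : dot C i j = (eps C i)%:Z * cartan C i j.
Proof.
have e0 := eps_gt0 i; have eE := dot_diagE i.
have [<-|/(dot_offdiag C)[n nE]] := eqVneq i j.
  rewrite /cartan mulzK; last by lia.
  by rewrite eE mulrC.
have cE : cartan C i j = - n%:Z by rewrite /cartan nE mulzK //; lia.
by rewrite cE; rewrite eE in nE; lia.
Qed.

Lemma cartan_offdiag i j : i != j -> cartan C i j = - (serre_exp i j)%:Z.
Proof.
move=> ij; have e0 := eps_gt0 i; have eE := dot_diagE i.
have [n nE] := dot_offdiag C ij.
have cE : cartan C i j = - n%:Z by rewrite /cartan nE mulzK //; lia.
by rewrite /serre_exp cE; lia.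
Qed.

Lemma serre_degE i j : i != j -> serre_deg C i j = (serre_exp i j).+1.
Proof. by move=> ij; rewrite /serre_deg cartan_offdiag //; lia. Qed.

Lemma qi_generic i : generic (qi K C i).
Proof.
rewrite /qi; case: (eps C i) (eps_gt0 i) => // n _.
exact: genericX n (qq_generic K).
Qed.

Lemma qi_dot_diag i : q ^ dot C i i = qi K C i ^+ 2.
Proof. by rewrite dot_diagE mulrC -exprz_exp. Qed.

Lemma qi_dot i j : i != j -> q ^ dot C i j = qi K C i ^- serre_exp i j.
Proof.
by move=> ij; rewrite dot_eps_cartan -exprz_exp cartan_offdiag // -invr_expz.
Qed.

Lemma serreE (A : algType (Kq K)) i j (x y : A) : i != j ->
  serre C i j x y = qserre (qi K C i) (serre_exp i j) x y.
Proof.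
move=> ij; have cE : 1 - cartan C i j = (serre_exp i j).+1%:Z.
  by rewrite cartan_offdiag //; lia.
by rewrite /serre (serre_degE ij) cE.
Qed.

Lemma idivpowE (vs : I -> Kq K) (A : algType (Kq K)) (p : 'Z_2) i m (b : A) :
  idivpow C vs p i m b = idp (qi K C i) (qi K C i * vs i) (p == 1) m b.
Proof. by rewrite idp.unlock. Qed.

Lemma iserreE (vs : I -> Kq K) (A : algType (Kq K)) (p : I -> 'Z_2) i j (B : I -> A) :
  i != j -> iserre C vs p i j B =
  iser (qi K C i) (qi K C i * vs i) (p i == 1) (serre_exp i j).+1 (B i) (B j).
Proof.
move=> ij; rewrite /iserre (serre_degE ij); apply: eq_bigr => n _.
rewrite !idivpowE cartan_offdiag //; congr (_ *: (idp _ _ _ _ _ * _ * _)).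
rewrite /= negbK mulrNz -pmulrn; move: (serre_exp i j) (p i) => m pi.
have -> : m%:R = (odd m)%:R :> 'Z_2.
  by rewrite -[in LHS](odd_double_half m) natrD -mul2n natrM pchar_Zp // mul0r addr0.
by case: (odd m); case: pi => [[|[|]]].
Qed.

Lemma free_eval_serre (G : choiceType) (A : algType (Kq K)) (g : G -> A) i j
  (u v : free_alg (Kq K) G) :
  free_eval g (serre C i j u v) = serre C i j (free_eval g u) (free_eval g v).
Proof.
rewrite free_eval_sum; apply: eq_bigr => n _.
by rewrite free_evalZ !free_evalM !free_evalX.
Qed.

Lemma free_eval_idivpow (vs : I -> Kq K) (G : choiceType) (A : algType (Kq K))
  (g : G -> A) (p : 'Z_2) i m (u : free_alg (Kq K) G) :
  free_eval g (idivpow C vs p i m u) = idivpow C vs p i m (free_eval g u).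
Proof.
have factorE (n : Kq K) : free_eval g (u ^+ 2 - n%:A) = free_eval g u ^+ 2 - n%:A.
  by rewrite free_evalB free_evalX free_evalZ free_eval1.
rewrite /idivpow free_evalZ; congr (_ *: _); case: ifP => _.
  rewrite free_evalM free_evalX; congr (_ * _).
  by rewrite free_eval_prod; apply: eq_bigr => j _; rewrite factorE.
case: ifP => _; last first.
  by rewrite free_eval_prod; apply: eq_bigr => j _; rewrite factorE.
rewrite free_evalM; congr (_ * _).
by rewrite free_eval_prod; apply: eq_bigr => j _; rewrite factorE.
Qed.

Lemma free_eval_iserre (vs : I -> Kq K) (G : choiceType) (A : algType (Kq K))
  (g : G -> A) (p : I -> 'Z_2) i j (B : I -> free_alg (Kq K) G) :
  free_eval g (iserre C vs p i j B) = iserre C vs p i j (fun l => free_eval g (B l)).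
Proof.
rewrite free_eval_sum; apply: eq_bigr => n _.
rewrite free_evalZ; congr (_ *: _).
apply: (etrans (free_evalM _ _ _)); congr (_ * _); last exact: free_eval_idivpow.
apply: (etrans (free_evalM _ _ _)); congr (_ * _); exact: free_eval_idivpow.
Qed.

Section CrossRelations.
Variables (D : root_datum C) (A : algType (Kq K)).
Variables (E F : I -> A) (Kh : Ylat D -> A).

(** The defining relations without the Serre relations. The operators on the free algebra satisfy
    these exactly, so that consequences can be shared between them and [U]. *)
Record cross_relations : Prop := CrossRelations {
  crossK0 : Kh 0 = 1;
  crossKK : forall h h', Kh h * Kh h' = Kh (h + h');
  crossKE : forall h i, Kh h * E i = q ^ pairing h (simple_root D i) *: (E i * Kh h);
  crossKF : forall h i, Kh h * F i = q ^ (- pairing h (simple_root D i)) *: (F i * Kh h);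
  crossEF : forall i j, E i * F j - F j * E i =
    if i == j then (qi K C i - (qi K C i)^-1)^-1 *: (Ktilde Kh i - Ktilde_inv Kh i) else 0
}.

Hypothesis cross : cross_relations.
Local Notation L := (Ktilde Kh).
Local Notation J := (Ktilde_inv Kh).

Lemma pairing0 h : pairing (0 : Ylat D) h = 0.
Proof. by apply/eqP; rewrite -(inj_eq (addrI (pairing 0 h))) -pairingDl !addr0. Qed.

Lemma pairingN (g : Ylat D) h : pairing (- g) h = - pairing g h.
Proof. by apply/eqP; rewrite -addr_eq0 -pairingDl addNr pairing0. Qed.

Lemma Ktilde_mulE i j : L i * E j = q ^ dot C i j *: (E j * L i).
Proof.
rewrite (exp_qcomm _ (crossKE cross _ _)) pairing_cartan dot_eps_cartan.
by rewrite mulrC -exprz_exp.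
Qed.

Lemma Ktilde_inv_mulE i j : J i * E j = q ^ (- dot C i j) *: (E j * J i).
Proof.
rewrite (exp_qcomm _ (crossKE cross _ _)) pairingN pairing_cartan dot_eps_cartan.
by rewrite mulrC -mulNr -exprz_exp.
Qed.

Lemma Ktilde_mulF i j : L i * F j = q ^ (- dot C i j) *: (F j * L i).
Proof.
rewrite (exp_qcomm _ (crossKF cross _ _)) pairing_cartan dot_eps_cartan.
by rewrite mulrC -mulNr -exprz_exp.
Qed.

Lemma Ktilde_inv_mulF i j : J i * F j = q ^ dot C i j *: (F j * J i).
Proof.
rewrite (exp_qcomm _ (crossKF cross _ _)) pairingN opprK pairing_cartan dot_eps_cartan.
by rewrite mulrC -exprz_exp.
Qed.

Lemma KhC h h' : Kh h * Kh h' = Kh h' * Kh h.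
Proof. by rewrite !(crossKK cross) addrC. Qed.

Lemma Ktilde_invC i j : J i * J j = J j * J i.
Proof. by apply: commrX; apply/commr_sym/commrX; apply: KhC. Qed.

Lemma Ktilde_mul_inv i : L i * J i = 1.
Proof.
rewrite /Ktilde /Ktilde_inv -exprMn_comm; last exact: KhC.
by rewrite (crossKK cross) subrr (crossK0 cross) expr1n.
Qed.

Lemma EF_diag i : E i * F i - F i * E i =
  (qi K C i - (qi K C i)^-1)^-1 *: (L i - J i).
Proof. by rewrite (crossEF cross) eqxx. Qed.

Lemma EF_offdiag i j : i != j -> E i * F j = F j * E i.
Proof.
by move=> ij; apply/eqP; rewrite -subr_eq0 (crossEF cross) (negPf ij).
Qed.

(** For [l = i] this is the end of the string in [comm_qad], for [l = j] it is [comm_qserre_base],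
    and otherwise [E l] commutes with both generators. It makes [vermaE] preserve the Serre
    ideal. *)
Lemma comm_serreF l i j : i != j -> GRing.comm (E l) (serre C i j (F i) (F j)).
Proof.
move=> ij; rewrite serreE //; have qg := qi_generic i.
have qd := qi_dot ij; have qd' : q ^ dot C j i = qi K C i ^- serre_exp i j.
  by rewrite dotC.
have [->|li] := eqVneq l i.
  apply: (comm_qserre qg (l := L i) (j := J i)).
  - by rewrite Ktilde_mulF -invr_expz qi_dot_diag.
  - by rewrite Ktilde_inv_mulF qi_dot_diag.
  - by rewrite Ktilde_mulF -invr_expz qd invrK.
  - by rewrite Ktilde_inv_mulF qd.
  - exact: EF_diag.
  - exact: EF_offdiag.
have [->|lj] := eqVneq l j.
  apply: (comm_qserre_base qg (l := L j) (j := J j)).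
  - by rewrite Ktilde_mulF -invr_expz qd' invrK.
  - by rewrite Ktilde_inv_mulF qd'.
  - exact: EF_diag.
  - by rewrite EF_offdiag // eq_sym.
rewrite qserre_qad //; apply: commr_sym; rewrite /GRing.comm -scalerAl -scalerAr.
by congr (_ *: _); apply/commr_sym/qad_comm; apply: EF_offdiag.
Qed.

(** As before with the roles of $K$ and $K^{-1}$ exchanged. It serves to derive the Serre relations
    for the operators [vermaE]. *)
Lemma comm_serreE l i j : i != j -> GRing.comm (F l) (serre C i j (E i) (E j)).
Proof.
move=> ij; rewrite serreE //; have qg := qi_generic i.
have qd := qi_dot ij; have qd' : q ^ dot C j i = qi K C i ^- serre_exp i j.
  by rewrite dotC.
have FE_diag l' : F l' * E l' - E l' * F l' =
    (qi K C l' - (qi K C l')^-1)^-1 *: (J l' - L l').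
  by rewrite -opprB EF_diag -scalerN opprB.
have [->|li] := eqVneq l i.
  apply: (comm_qserre qg (l := J i) (j := L i)).
  - by rewrite Ktilde_inv_mulE -invr_expz qi_dot_diag.
  - by rewrite Ktilde_mulE qi_dot_diag.
  - by rewrite Ktilde_inv_mulE -invr_expz qd invrK.
  - by rewrite Ktilde_mulE qd.
  - exact: FE_diag.
  - by rewrite EF_offdiag // eq_sym.
have [->|lj] := eqVneq l j.
  apply: (comm_qserre_base qg (l := J j) (j := L j)).
  - by rewrite Ktilde_inv_mulE -invr_expz qd' invrK.
  - by rewrite Ktilde_mulE qd'.
  - exact: FE_diag.
  - by rewrite EF_offdiag.
rewrite qserre_qad //; apply: commr_sym; rewrite /GRing.comm -scalerAl -scalerAr.
by congr (_ *: _); apply/commr_sym/qad_comm; apply/esym/EF_offdiag; rewrite eq_sym.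
Qed.

End CrossRelations.
End CartanDatum.

(** * Rank two: the i-Serre relations hold for the $B_i$ *)

Section QuantumAdjointTwist.
Variables (k : fieldType) (q : k) (A : algType k) (N : nat).
Implicit Types (e g t u : A).

(** Passing from $E_i,E_j$ to $E_iK_i^{-1},E_jK_j^{-1}$ only multiplies the q-commutators by scalars
    and Cartan elements. The same [b] occurs twice since the form is symmetric: $K_i$ acts on $E_j$
    as $K_j$ does on $E_i$. *)
Lemma qad_twist e g t u a b c : t * e = a *: (e * t) -> t * g = b *: (g * t) ->
  u * e = b *: (e * u) -> t * u = u * t ->
  forall n, exists s, qad q N (c *: (e * t)) (g * u) n =
    s *: (qad q N e g n * (u * t ^+ n)).
Proof.
move=> te tg ue tu; elim=> [|n [s IH]].
  by exists 1; rewrite expr0 mulr1 scale1r.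
exists (s * c * (a ^+ n * b)); rewrite /= IH; set h := qad q N e g n.
have th : t * h = (a ^+ n * b) *: (h * t) by apply: qad_qcomm.
have tut : t * (u * t ^+ n) = u * t ^+ n.+1.
  by rewrite mulrA tu -mulrA -exprS.
have tne := exp_qcomm n te.
have lE : c *: (e * t) * (s *: (h * (u * t ^+ n))) =
    (s * c) *: (e * (t * h) * (u * t ^+ n)).
  by nc_algebra; ring.
have rE : s *: (h * (u * t ^+ n)) * (c *: (e * t)) =
    (s * c) *: (h * (u * (t ^+ n * e) * t)).
  by nc_algebra; ring.
rewrite lE rE th tne.
have -> : u * (a ^+ n *: (e * t ^+ n)) * t = (a ^+ n * b) *: (e * (u * t ^+ n.+1)).
  have -> : u * (a ^+ n *: (e * t ^+ n)) * t = a ^+ n *: (u * e * (t ^+ n * t)).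
    by nc_algebra; ring.
  by rewrite ue -exprSr; move: (t ^+ n.+1) => v; nc_algebra; ring.
have -> : e * ((a ^+ n * b) *: (h * t)) * (u * t ^+ n) =
   (a ^+ n * b) *: (e * h * (t * (u * t ^+ n))).
  by nc_algebra; ring.
rewrite tut; move: (u * t ^+ n.+1) => v.
by nc_algebra; ring.
Qed.

End QuantumAdjointTwist.

Lemma qcomm_sym (k : fieldType) (A : algType k) (x y : A) a : a != 0 ->
  x * y = a *: (y * x) -> y * x = a^-1 *: (x * y).
Proof. by move=> a0 ->; rewrite scalerA mulVf // scale1r. Qed.

Section QserreInverse.
Variables (k : fieldType) (q : k) (A : algType k) (N : nat).

Lemma qbinomV (n : int) d : qbinom q^-1 n d = qbinom q n d.
Proof.
rewrite /qbinom /qfact; congr (_ / _); apply: eq_bigr => j _; exact: qintV.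
Qed.

Lemma qserreV (x y : A) : qserre q^-1 N x y = qserre q N x y.
Proof. by apply: eq_bigr => n _; rewrite qbinomV. Qed.

End QserreInverse.

Section RankTwo.
Variables (k : fieldType) (q : k).
Hypothesis q_gen : generic q.
Variables (A : algType k) (N : nat) (ei fi li ji ej fj jj : A).
Variables (vi ki vj kj : k).

Hypothesis lji : li * ji = 1.
Hypothesis ji_fi : ji * fi = q ^+ 2 *: (fi * ji).
Hypothesis ji_ei : ji * ei = q ^- 2 *: (ei * ji).
Hypothesis ji_fj : ji * fj = q ^- N *: (fj * ji).
Hypothesis ji_ej : ji * ej = q ^+ N *: (ej * ji).
Hypothesis jj_fi : jj * fi = q ^- N *: (fi * jj).
Hypothesis jj_ei : jj * ei = q ^+ N *: (ei * jj).
Hypothesis ji_jj : ji * jj = jj * ji.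
Hypothesis ei_fi : ei * fi - fi * ei = (q - q^-1)^-1 *: (li - ji).
Hypothesis ei_fj : ei * fj = fj * ei.
Hypothesis ej_fi : ej * fi = fi * ej.
Hypothesis serre_f : qserre q N fi fj = 0.
Hypothesis serre_e : qserre q N ei ej = 0.
Hypothesis even_N : kj != 0 -> ~~ odd N.

Lemma iser_rank_two r : iser q (q * vi) r N.+1 (fi + vi *: (ei * ji) + ki *: ji)
  (fj + vj *: (ej * jj) + kj *: jj) = 0.
Proof.
have q0 := generic_neq0 q_gen; have qX0 n : q ^+ n != 0 by rewrite expf_neq0.
pose y := vi *: (ei * ji).
have yx : y * fi = q ^+ 2 *: (fi * y) + (q ^+ 2 * vi / (q - q^-1)) *: (1 - ji * ji).
  have efi : ei * fi = fi * ei + (q - q^-1)^-1 *: (li - ji).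
    by rewrite -ei_fi addrC subrK.
  rewrite /y -scalerAl -(mulrA ei) ji_fi -scalerAr (mulrA ei) efi.
  rewrite (mulrDl (fi * ei)) -scalerAl mulrBl lji.
  by nc_algebra; ring.
have Jy : ji * y = q ^- 2 *: (y * ji).
  by rewrite /y -scalerAr (mulrA ji) ji_ei; nc_algebra; ring.
have yJ : y * ji = q ^+ 2 *: (ji * y).
  by rewrite -[q ^+ 2]invrK; apply: qcomm_sym Jy; rewrite invr_eq0.
have fi_jj : fi * jj = q ^+ N *: (jj * fi).
  by rewrite -[q ^+ N]invrK; apply: qcomm_sym jj_fi; rewrite invr_eq0.
have ei_jj : ei * jj = q ^- N *: (jj * ei) by apply: qcomm_sym jj_ei.
have partF : iser q (q * vi) r N.+1 (fi + y + ki *: ji) fj = 0.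
  apply: iser_qad => //.
    rewrite /y -scalerAl -(mulrA ei) ji_fj -scalerAr (mulrA ei) ei_fj.
    by nc_algebra; ring.
  by rewrite qad_serre // serre_f scaler0.
(* [fi] and [y] exchange roles and [q] is inverted; the parameter becomes $q^2v_i$, since
   $q^{-1}(q^2v_i)=qv_i$. *)
have partE : iser q (q * vi) r N.+1 (fi + y + ki *: ji) (ej * jj) = 0.
  have qgV := genericV q_gen.
  have qvs : q * vi = q^-1 * (q ^+ 2 * vi) by field; rewrite q0.
  rewrite -iserV qvs (addrC fi).
  apply: iser_qad => //.
  - have q2 : 1 + - q * q != 0 by rewrite mulNr -oppr_eq0 opprB (generic_sqr q_gen).
    by rewrite invrK yx; nc_algebra; field; rewrite ?q0 ?q2 ?(generic_sqr q_gen).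
  - by rewrite Jy exprVn.
  - by rewrite exprVn invrK (mulrA ji) ji_ej -scalerAl -(mulrA ej ji) ji_jj (mulrA ej).
  - by rewrite exprVn invrK (mulrA fi) -ej_fi -(mulrA ej fi) fi_jj; nc_algebra; ring.
  - have [s ->] := qad_twist q^-1 N vi ji_ei ji_ej jj_ei ji_jj N.+1.
    by rewrite qad_serre // qserreV serre_e scaler0 mul0r scaler0.
rewrite !(iserD, iserZ) -/y partF partE scaler0 !add0r.
have [->|/even_N evN] := eqVneq kj 0; first by rewrite scale0r.
have [m NE] : exists m, N = m.*2 by exists N./2; rewrite halfK (negPf evN) subn0.
rewrite NE (@iser_scalar_like _ _ q_gen _ vi ki fi y ji) ?scaler0 // -NE.
split=> //; rewrite /y -scalerAl -(mulrA ei ji) ji_jj (mulrA ei) ei_jj.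
by nc_algebra; ring.
Qed.

End RankTwo.

Section IQuantumRelations.
Variables (K : fieldType) (I : finType) (C : cartan_datum I).
Variables (D : root_datum C) (A : algType (Kq K)).
Variables (E F : I -> A) (Kh : Ylat D -> A).
Hypothesis cross : cross_relations E F Kh.
Hypothesis serreF0 : forall i j, i != j -> serre C i j (F i) (F j) = 0.
Hypothesis serreE0 : forall i j, i != j -> serre C i j (E i) (E j) = 0.
Variables (vs kap : I -> Kq K).
Hypothesis hpar : iparams D vs kap.

Lemma iserre_Belt (p : I -> 'Z_2) i j : i != j ->
  iserre C vs p i j (Belt vs kap E F Kh) = 0.
Proof.
move=> ij; rewrite iserreE //.
have qii := qi_dot_diag K C i; have qij := qi_dot K C ij.
have qji : qq K ^ dot C j i = qi K C i ^- serre_exp C i j by rewrite dotC.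
apply: (iser_rank_two (qi_generic K C i) (li := Ktilde Kh i)).
- exact: Ktilde_mul_inv cross i.
- by rewrite (Ktilde_inv_mulF cross) qii.
- by rewrite (Ktilde_inv_mulE cross) -invr_expz qii.
- by rewrite (Ktilde_inv_mulF cross) qij.
- by rewrite (Ktilde_inv_mulE cross) -invr_expz qij invrK.
- by rewrite (Ktilde_inv_mulF cross) qji.
- by rewrite (Ktilde_inv_mulE cross) -invr_expz qji invrK.
- exact: Ktilde_invC cross i j.
- exact: EF_diag cross i.
- exact: EF_offdiag cross _ _ ij.
- by apply: (EF_offdiag cross); rewrite eq_sym.
- by rewrite -serreE // serreF0.
- by rewrite -serreE // serreE0.
(* The condition on $\kappa_j$, taken at the coroot of [i], says that $a_{ij}$ is even. *)
move=> kj; have even_j l : (2 %| pairing (simple_coroot D l) (simple_root D j))%Z.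
  apply/negPn/negP => odd_l; case/negP: kj; apply/eqP.
  by case: hpar => _ hk; apply: hk => /(_ l); apply/negP.
by have := even_j i; rewrite pairing_cartan cartan_offdiag // dvdzE abszN dvdn2.
Qed.

End IQuantumRelations.

(** * A Verma module on the free algebra *)

(** Carries the relation between $K_h$ and $E_i$ from a vector [w] to [f w], for an induction on
    words; [g] is the commutator of [e] and [f]. *)
Lemma endo_cross_step (R : fieldType) (V : lalgType R) (k e f g : endo V) c d w :
  k * f = c *: (f * k) -> e * f = f * e + g -> k * g = g * k -> c * d *: g = g ->
  k (e w) = d *: e (k w) -> k (e (f w)) = d *: e (k (f w)).
Proof.
move=> kf ef kg cdg IH.
have kef : k * e * f = c *: (f * (k * e)) + g * k.
  by rewrite -mulrA ef mulrDr kg mulrA kf -scalerAl mulrA.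
have ekf : d *: (e * k * f) = (c * d) *: (f * (e * k)) + g * k.
  have -> : g * k = (c * d) *: (g * k) by rewrite scalerAl cdg.
  by rewrite -mulrA kf -scalerAr scalerA (mulrA e f k) ef mulrDl -(mulrA f e k)
    scalerDr (mulrC d).
have := congr1 (fun h : endo V => h w) kef.
have := congr1 (fun h : endo V => h w) ekf.
rewrite /= => -> ->.
by congr (_ + _); rewrite /= IH endoZ scalerA.
Qed.

Lemma mulr4A (R : pzRingType) (x y z w : R) : x * y * z * w = x * (y * z * w).
Proof. by rewrite !mulrA. Qed.

Section Verma.
Variables (K : fieldType) (I : finType) (C : cartan_datum I).
Variables (D : root_datum C).
Local Notation q := (qq K).
Local Notation FA := (free_alg (Kq K) I).

Inductive serre_rel : FA -> Prop :=
| serre_relator i j : i != j -> serre_rel (serre C i j (fvar i) (fvar j)).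

Local Notation SI := (ideal_of serre_rel).

(* Key locking the operators below, whose comparison up to conversion does not
   terminate in reasonable time. *)
Fact verma_key : unit. Proof. exact: tt. Qed.

Fact vermaF_linear i : linear (fun u : FA => fvar i * u).
Proof. by move=> a u v; rewrite mulrDr -scalerAr. Qed.
Definition vermaF : I -> endo FA := locked_with verma_key
  (fun i => Endo (introT (asboolP _) (vermaF_linear i))).

Definition weight (h : Ylat D) (s : seq I) : int :=
  \sum_(x <- s) pairing h (simple_root D x).

Definition vermaK : Ylat D -> endo FA := locked_with verma_key (fun h =>
  linear_endo (fext (fun s => q ^ (- weight h s) *: fword (Kq K) s))).

Local Notation L := (Ktilde vermaK).
Local Notation J := (Ktilde_inv vermaK).

(* The action of E_i on the Verma module, determined by E_i 1 = 0 and
   [E_i, F_x] = delta_ix (K_i - K_i^-1) / (q_i - q_i^-1). *)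
Fixpoint vermaE_word i (s : seq I) : FA :=
  if s is x :: s' then
    fvar x * vermaE_word i s' +
    (if i == x then (qi K C i - (qi K C i)^-1)^-1 *: (L i - J i : endo FA) (fword _ s')
     else 0)
  else 0.

Definition vermaE : I -> endo FA :=
  locked_with verma_key (fun i => linear_endo (fext (vermaE_word i))).

Lemma endo_wordP (f g : endo FA) : (forall s, f (fword _ s) = g (fword _ s)) -> f = g.
Proof. by move=> fg; apply: endoP; apply: linear_fext_eq. Qed.

Lemma vermaFE i u : vermaF i u = fvar i * u.
Proof. by rewrite /vermaF locked_withE. Qed.

Lemma vermaF_word i s : vermaF i (fword _ s) = fword _ (i :: s).
Proof. by rewrite fword_cons vermaFE. Qed.

Lemma vermaK_word h s : vermaK h (fword _ s) = q ^ (- weight h s) *: fword _ s.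
Proof. by rewrite /vermaK locked_withE; apply: fext_word. Qed.

Lemma vermaE_wordE i s : vermaE i (fword _ s) = vermaE_word i s.
Proof. by rewrite /vermaE locked_withE; apply: fext_word. Qed.

Lemma verma_cross : cross_relations vermaE vermaF vermaK.
Proof.
have q0 := generic_neq0 (qq_generic K).
have weightD h h' s : weight (h + h') s = weight h s + weight h' s.
  by rewrite /weight -big_split; apply: eq_bigr => x _; rewrite pairingDl.
have weight_cons h x s : weight h (x :: s) = pairing h (simple_root D x) + weight h s.
  exact: big_cons.
have KK h h' : vermaK h * vermaK h' = vermaK (h + h').
  apply: endo_wordP => s.
  rewrite endo_mulE (vermaK_word h' s) endoZ (vermaK_word h s) (vermaK_word (h + h') s).
  by rewrite scalerA weightD (addrC (weight h s)) opprD (expfzDr _ _ q0).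
have KF h i : vermaK h * vermaF i =
    q ^ (- pairing h (simple_root D i)) *: (vermaF i * vermaK h).
  apply: endo_wordP => s; rewrite endo_scaleE !endo_mulE vermaF_word !vermaK_word.
  by rewrite endoZ vermaF_word scalerA weight_cons opprD (expfzDr _ _ q0).
have EF i j : vermaE i * vermaF j - vermaF j * vermaE i =
    if i == j then (qi K C i - (qi K C i)^-1)^-1 *: (L i - J i) else 0.
  apply: endo_wordP => s; rewrite endo_addE endo_oppE !endo_mulE vermaF_word.
  rewrite !vermaE_wordE /= vermaFE addrC addKr.
  by case: ifP.
split=> // [|h i].
  apply: endo_wordP => s; rewrite vermaK_word /weight big1 ?oppr0 ?expr0z ?scale1r //.
  by move=> x _; apply: pairing0.
have EF' l x : vermaE l * vermaF x = vermaF x * vermaE l +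
    (if l == x then (qi K C l - (qi K C l)^-1)^-1 *: (L l - J l) else 0).
  by rewrite -EF addrC subrK.
have KhC h' : GRing.comm (vermaK h) (vermaK h') by rewrite /GRing.comm !KK addrC.
apply: endo_wordP; elim=> [|x s IH].
  by rewrite endo_scaleE !endo_mulE vermaK_word endoZ vermaE_wordE endo_fun0 !scaler0.
rewrite -vermaF_word.
apply: (endo_cross_step (KF h x) (EF' i x)); last exact: IH.
  case: ifP => _; last by rewrite mulr0 mul0r.
  rewrite -scalerAr -scalerAl; congr (_ *: _).
  by apply: (commrB (x := vermaK h)); apply: commrX; apply: KhC.
(* For [i = x] the exponents for $E_i$ and $F_i$ cancel; otherwise the commutator is zero. *)
have [->|_] := eqVneq i x; last by rewrite scaler0.
by rewrite -expfzDr // addNr expr0z scale1r.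
Qed.

(** Each monomial ends in some $E$ and kills 1; since the sum commutes with all [vermaF], it then
    kills every word. *)
Lemma verma_serreE i j : i != j -> serre C i j (vermaE i) (vermaE j) = 0.
Proof.
move=> ij; apply: endo_wordP => s; rewrite endo_zeroE.
have E1 l : vermaE l 1 = 0 by rewrite -fword_nil vermaE_wordE.
elim: s => [|x s IH]; last first.
  rewrite -vermaF_word -endo_mulE -(comm_serreE verma_cross x ij) endo_mulE IH.
  exact: endo_fun0.
rewrite fword_nil /serre.
have sum1 (J' : Type) (r : seq J') (P : pred J') (h : J' -> endo FA) :
    (forall n, P n -> h n 1 = 0) -> (\sum_(n <- r | P n) h n) 1 = 0.
  move=> h0; elim/big_rec: _ => [|n f /h0 hn f0]; first exact: endo_zeroE.
  by rewrite endo_addE hn f0 addr0.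
apply: sum1 => n _; rewrite endo_scaleE 2!endo_mulE.
case: (serre_deg C i j - n)%N => [|m].
  by rewrite expr0 endo_oneE E1 !endo_fun0 scaler0.
by rewrite exprSr endo_mulE E1 !endo_fun0 scaler0.
Qed.

Lemma verma_serreF i j u :
  serre C i j (vermaF i) (vermaF j) u = serre C i j (fvar i) (fvar j) * u.
Proof.
have FX l n v : (vermaF l ^+ n) v = fvar l ^+ n * v.
  elim: n v => [|n IH] v; first by rewrite !expr0 mul1r endo_oneE.
  by rewrite !exprS endo_mulE IH vermaFE mulrA.
rewrite /serre mulr_suml.
elim/big_rec2: _ => [|n v f _ IH]; first exact: endo_zeroE.
rewrite endo_addE IH endo_scaleE 2!endo_mulE; congr (_ + _).
rewrite -scalerAl; congr (_ *: _).
rewrite (FX i n).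
rewrite vermaFE.
rewrite (FX i (serre_deg C i j - n)%N u).
rewrite -[RHS]mulrA.
by rewrite -[RHS]mulrA.
Qed.

(** Stands for descending to the quotient by the Serre ideal. *)
Definition stable (f : endo FA) := forall u, SI u -> SI (f u).

Lemma stable_ind (f : endo FA) :
  (forall i j u, i != j -> SI (f (serre C i j (fvar i) (fvar j) * u))) ->
  (forall x u, SI u -> SI (f u) -> SI (f (fvar x * u))) -> stable f.
Proof.
move=> fS fF u; elim=> [|v w _ IHv _ IHw|v r w rr].
- by rewrite endo_fun0; constructor.
- by rewrite endoD; constructor.
elim/free_alg_ind: v => [|a s v IHv].
  by rewrite !mul0r endo_fun0; constructor.
have -> : (a *: fword _ s + v) * r * w = a *: (fword _ s * r * w) + v * r * w.
  by rewrite (mulr_linl a (fword _ s) v r); exact: mulr_linl.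
rewrite endoD endoZ; apply: ideal_ofD; last exact: IHv.
apply: ideal_ofZ.
elim: s => [|x s IH]; first by rewrite fword_nil mul1r; case: rr => i j; apply: fS.
have -> : fword _ (x :: s) * r * w = fvar x * (fword _ s * r * w).
  by rewrite fword_cons; exact: mulr4A.
by apply: fF IH; apply: ideal_ofM.
Qed.

Lemma stableM f g : stable f -> stable g -> stable (f * g).
Proof. by move=> sf sg u /sg/sf. Qed.

Lemma stableX f n : stable f -> stable (f ^+ n).
Proof.
move=> sf; elim: n => [|n IH]; first by rewrite expr0 => u.
by rewrite exprS; apply: stableM.
Qed.

Lemma stableD f g : stable f -> stable g -> stable (f + g).
Proof. by move=> sf sg u su; apply: ideal_ofD; [apply: sf | apply: sg]. Qed.

Lemma stableZ a f : stable f -> stable (a *: f).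
Proof. by move=> sf u su; apply/ideal_ofZ/sf. Qed.

Lemma stable0 : stable 0.
Proof. by move=> u _; rewrite endo_zeroE; constructor. Qed.

Lemma stable_vermaF i : stable (vermaF i).
Proof. by move=> u; rewrite vermaFE; apply: ideal_ofMl. Qed.

Lemma stable_vermaK h : stable (vermaK h).
Proof.
apply: stable_ind => [i j u ij|x u _ Ku].
  rewrite -verma_serreF -endo_mulE serreE // qserre_qad; last exact: qi_generic.
  rewrite -scalerAr (qad_qcomm _ _ _ (crossKF verma_cross h i) (crossKF verma_cross h j)).
  rewrite scalerA mulrC -scalerA scalerAl -qserre_qad; last exact: qi_generic.
  rewrite endo_scaleE endo_mulE -serreE // verma_serreF; apply: ideal_ofZ.
  by apply: ideal_ofMr; apply: ideal_of_rel; apply: serre_relator.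
rewrite -vermaFE -endo_mulE (crossKF verma_cross) endo_scaleE.
by apply/ideal_ofZ/stable_vermaF.
Qed.

Lemma stable_vermaE l : stable (vermaE l).
Proof.
apply: stable_ind => [i j u ij|x u su Eu].
  rewrite -verma_serreF -endo_mulE (comm_serreF verma_cross l ij).
  rewrite endo_mulE verma_serreF.
  by apply: ideal_ofMr; apply: ideal_of_rel; apply: serre_relator.
have EF' : vermaE l * vermaF x = vermaF x * vermaE l +
    (if l == x then (qi K C l - (qi K C l)^-1)^-1 *: (L l - J l) else 0).
  by rewrite -(crossEF verma_cross) addrC subrK.
rewrite -vermaFE -endo_mulE EF'.
rewrite endo_addE; apply: ideal_ofD; first by rewrite endo_mulE; apply: stable_vermaF.
case: ifP => _; last exact: stable0 su.
have sLJ : stable (L l - J l).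
  rewrite -scaleN1r; apply: stableD; last apply: stableZ; apply: stableX;
    exact: stable_vermaK.
exact: stableZ sLJ _ su.
Qed.

Local Notation act := (free_eval (qgroup_gen vermaE vermaF vermaK)).

(** All relators act by zero, except the Serre relators in the $F_i$, which act as left
    multiplication by Serre elements. *)
Lemma verma_rel r u : @qgroup_rel K I C D r -> SI (act r u).
Proof.
have aK h : act (fK K h) = vermaK h by apply: free_eval_var.
have aE i : act (fE K D i) = vermaE i by apply: free_eval_var.
have aF i : act (fF K D i) = vermaF i by apply: free_eval_var.
have zero w : act w = 0 -> SI (act w u) by move=> ->; apply: ideal_of0.
case=> [|h h'|h i|h i|i j|i j ij|i j ij].
- apply/zero/free_evalB_eq0/free_eval1.
  exact: etrans (aK 0) (crossK0 verma_cross).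
- apply/zero/free_evalB_eq0/aK.
  exact: etrans (free_evalM_eq (aK h) (aK h')) (crossKK verma_cross h h').
- apply/zero/free_evalB_eq0/free_evalZ_eq/free_evalM_eq; [|exact: aE|exact: aK].
  exact: etrans (free_evalM_eq (aK h) (aE i)) (crossKE verma_cross h i).
- apply/zero/free_evalB_eq0/free_evalZ_eq/free_evalM_eq; [|exact: aF|exact: aK].
  exact: etrans (free_evalM_eq (aK h) (aF i)) (crossKF verma_cross h i).
- apply/zero/free_evalB_eq0.
    exact: etrans (free_evalB_eq (free_evalM_eq (aE i) (aF j))
      (free_evalM_eq (aF j) (aE i))) (crossEF verma_cross i j).
  case: ifP => _; last exact: free_eval0.
  by apply/free_evalZ_eq/free_evalB_eq; apply/free_evalX_eq/aK.
- apply/zero.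
  apply: (etrans (free_eval_serre C (qgroup_gen vermaE vermaF vermaK) i j _ _)).
  by rewrite (aE i) (aE j) verma_serreE.
- have -> : act (serre C i j (fF K D i) (fF K D j)) =
      serre C i j (vermaF i) (vermaF j).
    apply: (etrans (free_eval_serre C (qgroup_gen vermaE vermaF vermaK) i j _ _)).
    by rewrite (aF i) (aF j).
  rewrite verma_serreF.
  by apply: ideal_ofMr; apply: ideal_of_rel; apply: serre_relator.
Qed.

Lemma verma_stable w : stable (act w).
Proof.
elim/free_alg_ind: w => [|a s w IH]; first by rewrite free_eval0; apply: stable0.
rewrite free_evalD free_evalZ; apply: stableD IH; apply: stableZ.
rewrite free_eval_word; elim/big_rec: _ => [|x f _]; first by move=> u.
apply: stableM; case: x => [[i|i]|h].
- exact: stable_vermaE.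
- exact: stable_vermaF.
- exact: stable_vermaK.
Qed.

Lemma verma_ideal w u : ideal_of (@qgroup_rel K I C D) w -> SI (act w u).
Proof.
move=> iw; elim: iw u => [|v1 v2 _ IH1 _ IH2|a r b rr] u.
- by rewrite free_eval0; apply: ideal_of0.
- have -> : act (v1 + v2) u = act v1 u + act v2 u.
    exact: (congr1 (fun f : endo FA => f u) (free_evalD _ v1 v2)).
  exact: ideal_ofD (IH1 u) (IH2 u).
have -> : act (a * r * b) u = act a (act r (act b u)).
  apply: (congr1 (fun f : endo FA => f u) (y := act a * act r * act b)).
  by apply: free_evalM_eq; [exact: free_evalM | ].
exact/verma_stable/verma_rel.
Qed.

End Verma.

(** * Degrees and leading terms *)

Section LeadingIdentities.
Variables (R : fieldType) (A : algType R).
Implicit Types (u v x y : A).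

Lemma leading_step (b u1 u0 x : A) (t e f : R) : t != 0 ->
  t^-1 *: (b * u1 - e *: u0) - (f * t)^-1 *: (b * x) =
  t^-1 *: (b * (u1 - f^-1 *: x) - e *: u0).
Proof.
move=> t0; rewrite invfM mulrC -scalerA -scalerBr.
by congr (_ *: _); rewrite mulrBr -scalerAr addrAC.
Qed.

Lemma leading_term u y v x z (a b : R) :
  u * y * v - (a * b) *: (x * y * z) =
  (u - a *: x) * y * v + a *: (x * y * (v - b *: z)).
Proof. by nc_algebra; ring. Qed.

End LeadingIdentities.

Section Degree.
Variables (R : fieldType) (G : choiceType).
Local Notation FA := (free_alg R G).
Local Notation fword := (@fword R G).
Implicit Types (P Q : pred nat) (u v : FA).

(** A predicate on word lengths covers both homogeneous elements ([pred1 d]) and bounded degrees,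
    which occur together in products. *)
Inductive deg_in P : FA -> Prop :=
| deg_in0 : deg_in P 0
| deg_in_word a s u : P (size s) -> deg_in P u -> deg_in P (a *: fword s + u).

Local Notation deg_lt d := (deg_in (fun n => (n < d)%N)).

Lemma deg_inD P u v : deg_in P u -> deg_in P v -> deg_in P (u + v).
Proof.
move=> pu pv; elim: pu => [|a s w ps _ IH]; first by rewrite add0r.
by rewrite -addrA; apply: deg_in_word.
Qed.

Lemma deg_inZ P a u : deg_in P u -> deg_in P (a *: u).
Proof.
elim=> [|b s w ps _ IH]; first by rewrite scaler0; apply: deg_in0.
by rewrite scalerDr scalerA; apply: deg_in_word.
Qed.

Lemma deg_inB P u v : deg_in P u -> deg_in P v -> deg_in P (u - v).
Proof. by move=> pu pv; rewrite -scaleN1r; apply: deg_inD => //; apply: deg_inZ. Qed.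

Lemma deg_in_sum P (J : Type) (r : seq J) (p : pred J) (h : J -> FA) :
  (forall i, p i -> deg_in P (h i)) -> deg_in P (\sum_(i <- r | p i) h i).
Proof.
by move=> ph; elim/big_ind: _ => //; [apply: deg_in0 | apply: deg_inD].
Qed.

Lemma deg_in_fword P s : P (size s) -> deg_in P (fword s).
Proof.
move=> ps; have -> : fword s = 1 *: fword s + 0 by rewrite scale1r addr0.
exact: deg_in_word ps (deg_in0 P).
Qed.

Lemma deg_in_sub P Q u : (forall n, P n -> Q n) -> deg_in P u -> deg_in Q u.
Proof.
move=> PQ; elim=> [|a s w /PQ qs _ IH]; first exact: deg_in0.
exact: deg_in_word qs IH.
Qed.

Lemma deg_inM P Q (S : pred nat) u v : (forall a b, P a -> Q b -> S (a + b)%N) ->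
  deg_in P u -> deg_in Q v -> deg_in S (u * v).
Proof.
move=> PQS pu qv; elim: pu => [|a s w ps _ IH]; first by rewrite mul0r; apply: deg_in0.
rewrite (mulr_linl a (fword s) w v); apply: deg_inD IH; apply: deg_inZ.
elim: qv => [|b t x qt _ IH]; first by rewrite mulr0; apply: deg_in0.
rewrite (mulr_linr b (fword t) x (fword s)) -fword_cat; apply: deg_in_word IH.
by rewrite size_cat; apply: PQS.
Qed.

Lemma deg_lt0 u : deg_lt 0 u -> u = 0.
Proof. by case. Qed.

Lemma deg_lt_bound u : exists d, deg_lt d u.
Proof.
elim/free_alg_ind: u => [|a s u [d du]]; first by exists 0%N; apply: deg_in0.
exists (maxn d (size s).+1); apply: deg_in_word; first by rewrite leq_maxr.
by apply: deg_in_sub du => n nd; rewrite leq_max nd.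
Qed.

Definition hcomp (d : nat) : FA -> FA :=
  fext (fun s => if size s == d then fword s else 0).

Lemma hcompD d u v : hcomp d (u + v) = hcomp d u + hcomp d v.
Proof. exact: linearD. Qed.
Lemma hcompZ d a u : hcomp d (a *: u) = a *: hcomp d u.
Proof. exact: linearZ. Qed.
Lemma hcomp0 d : hcomp d 0 = 0.
Proof. exact: linear0. Qed.
Lemma hcompB d u v : hcomp d (u - v) = hcomp d u - hcomp d v.
Proof. exact: linearB. Qed.
Lemma hcomp_word d s : hcomp d (fword s) = if size s == d then fword s else 0.
Proof. exact: fext_word. Qed.

Lemma hcomp_eq0 P d u : ~~ P d -> deg_in P u -> hcomp d u = 0.
Proof.
move=> pd; elim=> [|a s w ps _ IH]; first exact: hcomp0.
rewrite hcompD hcompZ IH hcomp_word; case: eqP => [sd|_]; last by rewrite scaler0 addr0.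
by rewrite -sd ps in pd.
Qed.

Lemma hcomp_id d u : deg_in (pred1 d) u -> hcomp d u = u.
Proof.
elim=> [|a s w ps _ IH]; first exact: hcomp0.
by rewrite hcompD hcompZ IH hcomp_word (eqP ps) eqxx.
Qed.

Lemma deg_lt_sub_hcomp d u : deg_lt d.+1 u -> deg_lt d (u - hcomp d u).
Proof.
elim=> [|a s w sd _ IH]; first by rewrite hcomp0 subrr; apply: deg_in0.
rewrite hcompD hcompZ opprD addrACA -scalerBr; apply: deg_inD IH; apply: deg_inZ.
rewrite hcomp_word; case: eqP => [_|/eqP s_d]; first by rewrite subrr; apply: deg_in0.
by rewrite subr0; apply: deg_in_fword; rewrite ltn_neqAle s_d -ltnS.
Qed.

Lemma deg_in_fvar P x : P 1%N -> deg_in P (fvar x).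
Proof.
move=> p1; rewrite -[fvar x]mulr1 -(@fword_nil R G) -fword_cons.
exact: deg_in_fword.
Qed.

Lemma deg_in_fvarX x n : deg_in (pred1 n) (fvar x ^+ n).
Proof.
elim: n => [|n IH]; first by rewrite expr0 -(@fword_nil R G); apply: deg_in_fword.
rewrite exprS; apply: deg_inM IH; last by apply: (@deg_in_fvar (pred1 1%N)).
by move=> a b /eqP-> /eqP->; rewrite /= add1n.
Qed.

Lemma deg_in_fvarX_fvar x y n : deg_in (pred1 n.+1) (fvar x ^+ n * fvar y : FA).
Proof.
apply: deg_inM (deg_in_fvarX x n) (@deg_in_fvar (pred1 1%N) y (eqxx _)).
by move=> i j /eqP-> /eqP->; rewrite /= addn1.
Qed.

Lemma deg_lt_pred1 n u : deg_in (pred1 n) u -> deg_lt n.+1 u.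
Proof. by apply: deg_in_sub => m /eqP->. Qed.

Section Leading.
Variable q : R.
Hypothesis q_gen : generic q.

Lemma qbinom_qfact n d : (d <= n)%N ->
  qbinom q n d = qfact q n / (qfact q d * qfact q (n - d)).
Proof.
have nz m := qfact_neq0 q_gen m.
move=> dn; rewrite /qbinom -[in RHS](subnK dn) addnC.
suff -> : \prod_(j < d) qint q (n%:Z - j%:Z) = qfact q n / qfact q (n - d).
  by rewrite subnKC //; field; rewrite !nz.
elim: d dn => [|d IH] dn; first by rewrite big_ord0 subn0 divff.
rewrite big_ord_recr /= IH ?(ltnW dn) // subzn ?(ltnW dn) //.
rewrite -(subnSK dn) qfactS; field.
by rewrite !nz qint_neq0.
Qed.

Variables (c : R).

Local Notation idpx r n x := (idp q c r n (fvar x : FA)).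

Lemma idp_leading_deg r x n :
  deg_lt n (idpx r n x - (qfact q n)^-1 *: fvar x ^+ n) -> deg_lt n.+1 (idpx r n x).
Proof.
move=> ln; rewrite -[idpx r n x](subrK ((qfact q n)^-1 *: fvar x ^+ n)).
apply: deg_inD; first by apply: deg_in_sub ln => k /ltnW.
by apply: deg_inZ; apply/deg_lt_pred1/deg_in_fvarX.
Qed.

Lemma idp_leading r x n : deg_lt n (idpx r n x - (qfact q n)^-1 *: fvar x ^+ n).
Proof.
have qf0 : qfact q 0 = 1 by rewrite /qfact big_geq.
suff: deg_lt n (idpx r n x - (qfact q n)^-1 *: fvar x ^+ n) /\
  deg_lt n.+1 (idpx r n.+1 x - (qfact q n.+1)^-1 *: fvar x ^+ n.+1) by case.
elim: n => [|n [L0 L1]].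
  rewrite idp0 idp1 // expr0 expr1 qfactS qf0 mul1r [qint q 1%N]qint1 //.
  by rewrite !invr1 !scale1r !subrr; split; apply: deg_in0.
split; first exact: L1.
have nz : qint q n.+2 != 0 by apply: qint_neq0.
have step : idpx r n.+2 x = (qint q n.+2)^-1 *: (fvar x * idpx r n.+1 x -
    (if odd n.+1 == r then c * qint q n.+1 else 0) *: idpx r n x).
  by rewrite idpS // addrK scalerA mulVf // scale1r.
rewrite step (qfactS q n.+1) (exprS _ n.+1) (leading_step _ _ _ _ _ _ nz).
apply: deg_inZ; apply: deg_inB.
  apply: deg_inM L1; last by apply: (@deg_in_fvar (pred1 1%N)).
  by move=> a d /eqP-> ; rewrite add1n ltnS.
apply: deg_inZ; apply: deg_in_sub (idp_leading_deg L0) => k /leq_trans; apply.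
exact: leqnSn.
Qed.

(** The leading term of an idivided power is $x^n/[n]!$, and $1/([n]!\,[l]!)$ is the q-binomial
    coefficient over $[n+l]!$. The parities affect lower terms only. *)
Lemma iser_leading r x y m :
  deg_lt m.+2 (iser q c r m.+1 (fvar x : FA) (fvar y) -
    (qfact q m.+1)^-1 *: qserre q m (fvar x : FA) (fvar y)).
Proof.
rewrite /iser /qserre scaler_sumr -sumrB; apply: deg_in_sum => -[n /= nm] _.
have nz k := qfact_neq0 q_gen k.
rewrite qbinom_qfact // scalerA.
set M := m.+1 in nm *; set l := (M - n)%N.
set r' := (_ (+) r).
have nl : (n + l = M)%N by rewrite subnKC.
pose a := (qfact q n)^-1; pose b := (qfact q l)^-1.
have -> : (qfact q M)^-1 * ((-1) ^+ n * (qfact q M / (qfact q n * qfact q l))) =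
    (-1) ^+ n * (a * b) by rewrite /a /b; field; rewrite !nz.
rewrite -scalerA -scalerBr; apply: deg_inZ.
rewrite leading_term.
have Xy := deg_in_fvarX_fvar x y n.
apply: deg_inD; last first.
  apply: deg_inZ; apply: deg_inM Xy (idp_leading r x l) => i j /eqP-> jl.
  by rewrite addSn ltnS -nl ltn_add2l.
apply: (@deg_inM (fun k => (k < n.+1)%N) (fun k => (k < l.+1)%N)); last first.
- exact/idp_leading_deg/idp_leading.
- apply: deg_inM (idp_leading r' x n) (@deg_in_fvar (pred1 1%N) y (eqxx _)).
  by move=> i j ni /eqP->; rewrite addn1.
by move=> i j ni jl; lia.
Qed.

Lemma deg_in_qserre x y m : deg_in (pred1 m.+2) (qserre q m (fvar x : FA) (fvar y)).
Proof.
apply: deg_in_sum => -[n /= nm] _; apply: deg_inZ.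
apply: (@deg_inM (pred1 n.+1) (pred1 (m.+1 - n)%N)) (deg_in_fvarX x _).
  by move=> i j /eqP-> /eqP->; rewrite /= addSn subnKC.
exact: deg_in_fvarX_fvar.
Qed.

End Leading.
End Degree.

Notation deg_lt d := (deg_in (fun n => (n < d)%N)).

(** * Reversal of words *)

Section Reversal.
Variables (R : fieldType) (G : choiceType).
Local Notation FA := (free_alg R G).
Local Notation fword := (@fword R G).

Definition frev : FA -> FA := fext (fun s => fword (rev s)).

Lemma frev_linear : linear frev. Proof. exact: linearP. Qed.
Lemma frev0 : frev 0 = 0. Proof. exact: linear0. Qed.
Lemma frevD u v : frev (u + v) = frev u + frev v. Proof. exact: linearD. Qed.
Lemma frevB u v : frev (u - v) = frev u - frev v. Proof. exact: linearB. Qed.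
Lemma frevZ a u : frev (a *: u) = a *: frev u. Proof. exact: linearZ. Qed.
Lemma frev_word s : frev (fword s) = fword (rev s). Proof. exact: fext_word. Qed.
Lemma frev_sum (J : Type) (r : seq J) (p : pred J) (h : J -> FA) :
  frev (\sum_(i <- r | p i) h i) = \sum_(i <- r | p i) frev (h i).
Proof. exact: raddf_sum. Qed.

Lemma frev1 : frev 1 = 1.
Proof. by rewrite -(@fword_nil R G) frev_word. Qed.

Lemma frev_var x : frev (fvar x) = fvar x.
Proof. by rewrite -[fvar x]mulr1 -(@fword_nil R G) -fword_cons frev_word. Qed.

Lemma frevM u v : frev (u * v) = frev v * frev u.
Proof.
elim/free_alg_ind: u => [|a s u IHu]; first by rewrite mul0r frev0 mulr0.
have -> : (a *: fword s + u) * v = a *: (fword s * v) + u * v by exact: mulr_linl.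
apply: (etrans (frev_linear a _ _)).
apply: (etrans _ (congr1 (fun w => frev v * w) (esym (frev_linear a _ _)))).
apply: (etrans _ (esym (mulr_linr _ _ _ _))).
apply: congr2 IHu; congr (_ *: _) => {u}.
elim/free_alg_ind: v => [|b t v IHv]; first by rewrite mulr0 frev0 mul0r.
have -> : fword s * (b *: fword t + v) = b *: (fword s * fword t) + fword s * v.
  exact: mulr_linr.
apply: (etrans (frev_linear b _ _)).
apply: (etrans _ (congr1 (fun w => w * frev (fword s)) (esym (frev_linear b _ _)))).
apply: (etrans _ (esym (mulr_linl _ _ _ _))).
apply: congr2 IHv; congr (_ *: _) => {v}.
by rewrite -fword_cat !frev_word rev_cat fword_cat.
Qed.

Lemma frevK : involutive frev.
Proof.
elim/free_alg_ind => [|a s u IHu]; first by rewrite !frev0.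
apply: (etrans (congr1 frev (frev_linear a _ _))).
apply: (etrans (frev_linear a _ _)); apply: congr2 IHu; congr (_ *: _).
by rewrite !frev_word revK.
Qed.

Lemma frev_ideal (rel : FA -> Prop) : (forall r, rel r -> ideal_of rel (frev r)) ->
  forall u, ideal_of rel u -> ideal_of rel (frev u).
Proof.
move=> rrel u; elim=> [|v w _ IHv _ IHw|v r w /rrel rr].
- by rewrite frev0; apply: ideal_of0.
- by rewrite frevD; apply: ideal_ofD.
by rewrite 2!frevM; apply: ideal_ofMl; apply: ideal_ofMr.
Qed.

Lemma presents_anti_involution (A : algType R) (g : G -> A) (rel : FA -> Prop) :
  presents g rel -> (forall r, rel r -> ideal_of rel (frev r)) ->
  exists sigma : {linear A -> A}, is_anti_involution sigma /\
    forall x, sigma (g x) = g x.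
Proof.
move=> [g_onto g_ker] rel_rev.
pose lift a := sval (cid (g_onto a)).
have liftK a : free_eval g (lift a) = a by rewrite /lift; case: cid.
pose sigma a := free_eval g (frev (lift a)).
(* Independence of the chosen lift: two lifts differ by an element of the ideal, and reversal
   preserves the ideal. *)
have sigmaE u : sigma (free_eval g u) = free_eval g (frev u).
  apply/eqP; rewrite -subr_eq0 -free_evalB -frevB; apply/eqP/g_ker/frev_ideal => //.
  by apply/g_ker; rewrite free_evalB liftK subrr.
have sigma_linear : linear sigma.
  move=> c a b; rewrite -[a]liftK -[b]liftK.
  by rewrite -free_evalZ -free_evalD !sigmaE frevD frevZ free_evalD free_evalZ.
pose s : {linear A -> A} :=
  HB.pack sigma (GRing.isLinear.Build R A A *:%R sigma sigma_linear).
exists s; split; last by move=> x; rewrite -(free_eval_var g x) /= sigmaE frev_var.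
split=> [|a b|a] /=.
- by rewrite -(free_eval1 g) sigmaE frev1.
- by rewrite -[a]liftK -[b]liftK -free_evalM !sigmaE frevM free_evalM.
- by rewrite -[a]liftK !sigmaE frevK.
Qed.

Section Iserre.
Variables (q c : R).
Hypothesis q_gen : generic q.

Lemma frev_idp r n x : frev (idp q c r n (fvar x : FA)) = idp q c r n (fvar x : FA).
Proof.
suff: frev (idp q c r n (fvar x : FA)) = idp q c r n (fvar x : FA) /\
  frev (idp q c r n.+1 (fvar x : FA)) = idp q c r n.+1 (fvar x : FA) by case.
elim: n => [|n [IH0 IH1]]; first by rewrite idp0 idp1 // frev1 frev_var.
split; first exact: IH1.
have nz : qint q n.+2 != 0 by apply: qint_neq0.
have step : idp q c r n.+2 (fvar x : FA) = (qint q n.+2)^-1 *: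
    (fvar x * idp q c r n.+1 (fvar x : FA) -
     (if odd n.+1 == r then c * qint q n.+1 else 0) *: idp q c r n (fvar x : FA)).
  by rewrite idpS // addrK scalerA mulVf // scale1r.
rewrite step; apply: (etrans (frevZ _ _)); congr (_ *: _).
apply: (etrans (frevB _ _)).
apply: (congr2 (fun v w => v - w)).
  apply: (etrans (frevM _ _)); apply: (etrans (congr2 *%R IH1 (frev_var x))).
  exact/esym/idp_comm.
by apply: (etrans (frevZ _ _)); congr (_ *: _).
Qed.

(** Reversal exchanges the two powers and hence their parities; [iser_parity] restores the original
    ones. Renumbering the sum produces the sign. *)
Lemma frev_iser r m x y : frev (iser q c r m (fvar x : FA) (fvar y)) =
  (-1) ^+ m *: iser q c r m (fvar x : FA) (fvar y).
Proof.
rewrite [in RHS](iser_parity q_gen c r (odd m.+1 (+) r)) /iser frev_sum scaler_sumr.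
rewrite (reindex_inj rev_ord_inj); apply: eq_bigr => -[n nm] _.
have nm' : (n <= m)%N := nm.
have -> : nat_of_ord (rev_ord (Ordinal nm)) = (m - n)%N by exact: subSS.
have -> : odd m.+1 (+) (odd m.+1 (+) r) = r by rewrite addbA addbb addFb.
have -> : nat_of_ord (Ordinal nm) = n by [].
have sgn : (-1) ^+ (m - n) = (-1) ^+ m * (-1) ^+ n :> R.
  by rewrite -exprD -signr_odd -[RHS]signr_odd oddD oddB.
rewrite sgn scalerA (subKn nm').
apply: (etrans (frevZ _ _)); apply: (congr1 (fun v => _ *: v)).
apply: (etrans (frevM _ _)); rewrite -[RHS]mulrA.
apply: congr2; first exact: frev_idp.
by apply: (etrans (frevM _ _)); apply: congr2; [apply: frev_var | apply: frev_idp].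
Qed.

End Iserre.
End Reversal.

(** * The presentation *)

Lemma leading_rescale (R : fieldType) (A : algType R) (u s t v : A) (a : R) :
  a != 0 -> u * s * v - a *: (u * t * v) = - a *: (u * (t - a^-1 *: s) * v).
Proof. by move=> a0; nc_algebra; field; rewrite ?a0. Qed.

Section Filtration.
Variables (K : fieldType) (I : finType) (C : cartan_datum I).
Variables (D : root_datum C) (vs kap : I -> Kq K) (p : I -> 'Z_2).
Local Notation FA := (free_alg (Kq K) I).
Local Notation fword := (@fword (Kq K) I).
Local Notation SI := (ideal_of (@serre_rel K I C)).
Local Notation BI := (ideal_of (iserre_rel C vs p)).

(** By linearity [u] may be taken to be a Serre element between two words, which is homogeneous; the
    same product with the i-Serre relator, rescaled, has it as leading term. *)
Lemma serre_ideal_leading (u : FA) : SI u ->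
  forall d, exists v, BI v /\ deg_lt d (hcomp d u - v).
Proof.
elim=> [|v w _ IHv _ IHw|v r0 w [i j ij]] d.
- by exists 0; split; [apply: ideal_of0 | rewrite hcomp0 subrr; apply: deg_in0].
- have [v' [Bv lv]] := IHv d; have [w' [Bw lw]] := IHw d.
  exists (v' + w'); split; first exact: ideal_ofD.
  by rewrite hcompD opprD addrACA; apply: deg_inD.
have comb (a : Kq K) x y : (exists z, BI z /\ deg_lt d (hcomp d x - z)) ->
    (exists z, BI z /\ deg_lt d (hcomp d y - z)) ->
    exists z, BI z /\ deg_lt d (hcomp d (a *: x + y) - z).
  move=> [x' [Bx lx]] [y' [By ly]]; exists (a *: x' + y'); split.
    by apply: ideal_ofD By; apply: ideal_ofZ.
  rewrite hcompD hcompZ opprD addrACA -scalerBr.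
  by apply: deg_inD ly; apply: deg_inZ.
have zero : exists z, BI z /\ deg_lt d (hcomp d 0 - z).
  by exists 0; split; [apply: ideal_of0 | rewrite hcomp0 subrr; apply: deg_in0].
elim/free_alg_ind: v => [|a s v IHv]; first by rewrite !mul0r.
set r := serre _ _ _ _ _ in IHv *.
have -> : (a *: fword s + v) * r * w = a *: (fword s * r * w) + v * r * w.
  by rewrite (mulr_linl a (fword s) v r); exact: mulr_linl.
apply: (comb _ _ _ _ IHv) => {v IHv}.
elim/free_alg_ind: w => [|b t w IHw]; first by rewrite mulr0.
have -> : fword s * r * (b *: fword t + w) =
    b *: (fword s * r * fword t) + fword s * r * w.
  exact: mulr_linr.
apply: (comb _ _ _ _ IHw) => {w IHw}.
have qg := qi_generic K C i; pose m := serre_exp C i j.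
have rE : r = qserre (qi K C i) m (fvar i : FA) (fvar j) by apply: serreE.
have r_deg : deg_in (pred1 m.+2) r by rewrite rE; apply: deg_in_qserre.
pose e := (size s + m.+2 + size t)%N.
have srt_deg : deg_in (pred1 e) (fword s * r * fword t).
  apply: (@deg_inM _ _ (pred1 (size s + m.+2)%N) (pred1 (size t))).
  - by move=> x y /eqP-> /eqP->; rewrite /=.
  - apply: (@deg_inM _ _ (pred1 (size s)) (pred1 m.+2)) r_deg.
      by move=> x y /eqP-> /eqP->; rewrite /=.
    by apply: deg_in_fword; rewrite /=.
  - by apply: deg_in_fword; rewrite /=.
have [ed|ed] := eqVneq d e; last first.
  exists 0; split; first exact: ideal_of0.
  by rewrite (hcomp_eq0 (P := pred1 e)) // subr0; apply: deg_in0.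
pose B := iserre C vs p i j (fvar : I -> FA).
have nz : qfact (qi K C i) m.+1 != 0 by apply: qfact_neq0.
exists (qfact (qi K C i) m.+1 *: (fword s * B * fword t)); split.
  by apply: ideal_ofZ; apply: ideal_ofM; apply: iserre_relator.
rewrite ed (hcomp_id srt_deg) leading_rescale //; apply: deg_inZ.
have B_deg : deg_lt m.+2 (B - (qfact (qi K C i) m.+1)^-1 *: r).
  by rewrite rE /B iserreE //; apply: iser_leading.
apply: (@deg_inM _ _ (fun n => (n < size s + m.+2)%N) (pred1 (size t))).
- by move=> x y xs /eqP->; rewrite /e ltn_add2r.
- apply: (@deg_inM _ _ (pred1 (size s)) (fun n => (n < m.+2)%N)) B_deg.
    by move=> x y /eqP->; rewrite ltn_add2l.
  by apply: deg_in_fword; rewrite /=.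
- by apply: deg_in_fword; rewrite /=.
Qed.

Local Notation vE := (vermaE K D).
Local Notation vF := (@vermaF K I).
Local Notation vK := (@vermaK K I C D).

Lemma deg_vermaK h d u : deg_lt d u -> deg_lt d (vK h u).
Proof.
elim=> [|a s w sd _ IH]; first by rewrite endo_fun0; apply: deg_in0.
rewrite endoD endoZ vermaK_word; apply: deg_inD IH; apply: deg_inZ; apply: deg_inZ.
exact: deg_in_fword.
Qed.

Lemma deg_vermaKX h n d u : deg_lt d u -> deg_lt d ((vK h ^+ n) u).
Proof.
elim: n u => [|n IH] u du; first by rewrite expr0.
by rewrite exprS endo_mulE; apply: deg_vermaK; apply: IH.
Qed.

(** Each term of [vermaE_word] has lost a letter; the weak bound is enough to make $F_i$ the leading
    part of $B_i$. *)
Lemma deg_vermaE i d u : deg_lt d u -> deg_lt d (vE i u).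
Proof.
elim=> [|a s w sd _ IH]; first by rewrite endo_fun0; apply: deg_in0.
rewrite endoD endoZ; apply: deg_inD IH; apply: deg_inZ.
apply: deg_in_sub (_ : deg_lt (size s) _) => [n /leq_trans|]; first by apply; apply: ltnW.
rewrite vermaE_wordE; elim: s {sd} => [|x s IH]; first exact: deg_in0.
apply: deg_inD.
  apply: (@deg_inM _ _ (pred1 1%N)) IH; last exact: (@deg_in_fvar _ _ (pred1 1%N)).
  by move=> m n /eqP->.
case: ifP => _; last exact: deg_in0.
have ss : deg_lt (size s).+1 (fword s) by apply: deg_in_fword => /=.
apply: deg_inZ; rewrite endo_addE endo_oppE; apply: deg_inB; exact: deg_vermaKX.
Qed.

Local Notation vB := (Belt vs kap vE vF vK).

Lemma vB_leading i d u : deg_lt d u -> deg_lt d (vB i u - fvar i * u).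
Proof.
move=> du.
have -> : vB i u = vF i u + vs i *: vE i (Ktilde_inv vK i u) + kap i *: Ktilde_inv vK i u.
  by [].
have dJ : deg_lt d (Ktilde_inv vK i u) by apply: deg_vermaKX.
have cancel (x y z : FA) : x + y + z - x = y + z by rewrite addrC !addrA addNr add0r.
rewrite vermaFE cancel; apply: deg_inD; apply: deg_inZ.
  exact: deg_vermaE.
exact: dJ.
Qed.

Lemma vB_word_leading s : deg_lt (size s) ((\prod_(x <- s) vB x) 1 - fword s).
Proof.
elim: s => [|x s IH]; first by rewrite big_nil fword_nil subrr; apply: deg_in0.
rewrite big_cons endo_mulE fword_cons; set f : endo FA := (\prod_(_ <- _) _) in IH *.
set u := f 1 in IH *.
have du : deg_lt (size s).+1 u.
  rewrite -(subrK (fword s) u); apply: deg_inD; last by apply: deg_in_fword => /=.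
  by apply: deg_in_sub IH => n /ltnW.
have -> : vB x u - fvar x * fword s = (vB x u - fvar x * u) + fvar x * (u - fword s).
  by rewrite mulrBr addrA subrK.
apply: deg_inD; first exact: vB_leading.
apply: (@deg_inM _ _ (pred1 1%N)) IH; last exact: (@deg_in_fvar _ _ (pred1 1%N)).
by move=> m n /eqP->.
Qed.

Lemma vB_eval_leading d u : deg_lt d.+1 u -> deg_lt d (free_eval vB u 1 - u).
Proof.
elim=> [|a s w sd _ IH]; first by rewrite free_eval0 endo_zeroE subrr; apply: deg_in0.
have -> : free_eval vB (a *: fword s + w) = a *: free_eval vB (fword s) + free_eval vB w.
  exact: free_eval_linear.
rewrite endo_addE endo_scaleE opprD addrACA -scalerBr; apply: deg_inD IH.
apply: deg_inZ; rewrite free_eval_word.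
by apply: deg_in_sub (vB_word_leading s) => n /leq_trans; apply.
Qed.

Section Presented.
Variables (U : algType (Kq K)) (E F : I -> U) (Kh : Ylat D -> U).
Hypothesis hU : is_qgroup E F Kh.
Hypothesis hpar : iparams D vs kap.
Local Notation B := (Belt vs kap E F Kh).

Lemma free_eval_Belt (A : algType (Kq K)) (E' F' : I -> A) (Kh' : Ylat D -> A) i :
  free_eval (qgroup_gen E' F' Kh')
    (Belt vs kap (@fE K I C D) (@fF K I C D) (@fK K I C D) i) = Belt vs kap E' F' Kh' i.
Proof.
have aJ : free_eval (qgroup_gen E' F' Kh') (Ktilde_inv (@fK K I C D) i) =
    Ktilde_inv Kh' i.
  by apply: free_evalX_eq; apply: free_eval_var.
apply: (etrans (free_evalD _ _ _)); apply: congr2; last exact: free_evalZ_eq.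
apply: (etrans (free_evalD _ _ _)); apply: congr2; first exact: free_eval_var.
by apply: free_evalZ_eq; apply: free_evalM_eq => //; apply: free_eval_var.
Qed.

(** Writing the $B_i$ in the free algebra on the generators of [U] turns [u] into an element of the
    ideal of relators, which maps the whole free algebra into the Serre ideal. *)
Lemma eval_Belt_ideal u : free_eval B u = 0 -> SI (free_eval vB u 1).
Proof.
pose b := Belt vs kap (@fE K I C D) (@fF K I C D) (@fK K I C D).
have comp (A : algType (Kq K)) (E' F' : I -> A) (Kh' : Ylat D -> A) :
    free_eval (qgroup_gen E' F' Kh') (free_eval b u) =
      free_eval (Belt vs kap E' F' Kh') u.
  apply: (etrans (free_eval_comp b u (free_eval_linear (qgroup_gen E' F' Kh'))
      (free_eval_monoid _))).
  by apply: eq_free_eval => i; apply: free_eval_Belt.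
rewrite -(comp _ E F Kh) -(comp _ vE vF vK) => bu0.
by apply: verma_ideal; apply/hU.2.
Qed.

Lemma qgroup_relation u v a b : qgroup_rel (u - v) ->
  free_eval (qgroup_gen E F Kh) u = a -> free_eval (qgroup_gen E F Kh) v = b -> a = b.
Proof.
move=> /ideal_of_rel/hU.2; rewrite free_evalB => + <- <-.
by move/eqP; rewrite subr_eq0 => /eqP.
Qed.

Lemma qgroup_cross : cross_relations E F Kh.
Proof.
have gK h : free_eval (qgroup_gen E F Kh) (@fK K I C D h) = Kh h by apply: free_eval_var.
have gE i : free_eval (qgroup_gen E F Kh) (@fE K I C D i) = E i by apply: free_eval_var.
have gF i : free_eval (qgroup_gen E F Kh) (@fF K I C D i) = F i by apply: free_eval_var.
split=> [|h h'|h i|h i|i j].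
- exact: qgroup_relation (qgroup_K0 K D) (gK 0) (free_eval1 _).
- exact: qgroup_relation (qgroup_KK K h h') (free_evalM_eq (gK h) (gK h')) (gK _).
- exact: qgroup_relation (qgroup_KE K h i) (free_evalM_eq (gK h) (gE i))
    (free_evalZ_eq _ (free_evalM_eq (gE i) (gK h))).
- exact: qgroup_relation (qgroup_KF K h i) (free_evalM_eq (gK h) (gF i))
    (free_evalZ_eq _ (free_evalM_eq (gF i) (gK h))).
apply: (qgroup_relation (qgroup_EF K D i j)).
  exact: free_evalB_eq (free_evalM_eq (gE i) (gF j)) (free_evalM_eq (gF j) (gE i)).
case: ifP => _; last exact: free_eval0.
by apply/free_evalZ_eq/free_evalB_eq; apply/free_evalX_eq/gK.
Qed.

Lemma qgroup_serre0 (X : I -> free_alg (Kq K) (qgroup_index D)) (x : I -> U) i j :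
  qgroup_rel (serre C i j (X i) (X j)) ->
  (forall l, free_eval (qgroup_gen E F Kh) (X l) = x l) ->
  serre C i j (x i) (x j) = 0.
Proof.
move=> /ideal_of_rel/hU.2 + Xx; rewrite -!Xx => <-.
exact/esym/free_eval_serre.
Qed.

Lemma iserre_Belt0 i j : i != j -> iserre C vs p i j B = 0.
Proof.
apply: iserre_Belt; [exact: qgroup_cross | | | exact: hpar] => l m lm.
- by apply: (qgroup_serre0 (qgroup_SF K D lm)) => x; apply: free_eval_var.
- by apply: (qgroup_serre0 (qgroup_SE K D lm)) => x; apply: free_eval_var.
Qed.

Lemma eval_Belt_of_ideal u : BI u -> free_eval B u = 0.
Proof.
apply: free_eval_ideal => r [i j ij].
apply: (etrans (free_eval_iserre C vs B p i j fvar)).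
rewrite -[RHS](iserre_Belt0 ij); congr (iserre C vs p i j _).
by apply: funext => l; apply: free_eval_var.
Qed.

Lemma eval_Belt_eq0 u : free_eval B u = 0 <-> BI u.
Proof.
split; last exact: eval_Belt_of_ideal.
have [d du] := deg_lt_bound u.
elim: d u du => [|d IH] u du u0; first by rewrite (deg_lt0 du); apply: ideal_of0.
(* [v] matches the component of degree [d] of $u(B)1$, which is that of [u]; so [u - v] has smaller
   degree and still vanishes at the $B_i$. *)
have [v [Bv lv]] := serre_ideal_leading (eval_Belt_ideal u0) d.
have hu : hcomp d (free_eval vB u 1) = hcomp d u.
  apply/eqP; rewrite -subr_eq0 -hcompB; apply/eqP.
  by apply: hcomp_eq0 (vB_eval_leading du); rewrite ltnn.
rewrite -(subrK v u); apply: (ideal_ofD _ Bv); apply: IH.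
  have -> : u - v = (u - hcomp d u) + (hcomp d u - v) by rewrite addrA subrK.
  by apply: deg_inD; [apply: deg_lt_sub_hcomp | rewrite -hu].
by rewrite free_evalB u0 (eval_Belt_of_ideal Bv) subrr.
Qed.

End Presented.
End Filtration.

Lemma subalg_eval (R : fieldType) (G : choiceType) (A : algType R) (g : G -> A) u :
  val (free_eval (subalg_gen g) u) = free_eval g u.
Proof.
exact: (@free_eval_comp R G (subalg g) A val (subalg_gen g) u).
Qed.

Lemma subalg_eval_onto (R : fieldType) (G : choiceType) (A : algType R) (g : G -> A)
  (a : subalg g) : exists u, free_eval (subalg_gen g) u = a.
Proof.
suff [u ua] : exists u, free_eval g u = val a.
  by exists u; apply: val_inj; rewrite subalg_eval.
case: a => a /= /asboolP; elim=> [x||c b d _ [u <-] _ [v <-]|b d _ [u <-] _ [v <-]].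
- by exists (fvar x); apply: free_eval_var.
- by exists 1; apply: free_eval1.
- by exists (c *: u + v); apply: free_eval_linear.
- by exists (u * v); apply: free_evalM.
Qed.

Theorem theorem3p3 (K : fieldType) (charK : [pchar K] =i pred0)
    (I : finType) (C : cartan_datum I) (D : root_datum C)
    (U : algType (Kq K)) (E F : I -> U) (Kh : Ylat D -> U)
    (hU : is_qgroup E F Kh)
    (vs kap : I -> Kq K) (hpar : iparams D vs kap) (p : I -> 'Z_2) :
  presents (subalg_gen (Belt vs kap E F Kh)) (iserre_rel C vs p) /\
  exists sigma : {linear iqgroup vs kap E F Kh -> iqgroup vs kap E F Kh},
    is_anti_involution sigma /\
    forall i, sigma (subalg_gen (Belt vs kap E F Kh) i) =
              subalg_gen (Belt vs kap E F Kh) i.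
Proof.
have pres : presents (subalg_gen (Belt vs kap E F Kh)) (iserre_rel C vs p).
  split=> [|u]; first exact: subalg_eval_onto.
  rewrite -(eval_Belt_eq0 p hU hpar) -(subalg_eval (Belt vs kap E F Kh)).
  split=> [->|u0]; first by [].
  by apply: val_inj; rewrite u0 raddf0.
split; first exact: pres.
apply: (presents_anti_involution pres) => r [i j ij].
rewrite iserreE // frev_iser; last exact: qi_generic.
by apply: ideal_ofZ; rewrite -iserreE //; apply: ideal_of_rel; apply: iserre_relator.
Qed.
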